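(* Let $n\ge 1$. For each $i=1,\dots,n$ let $A^{(i)}=\{\omega^{(i)},\sigma^{(i)},\bar 0\}\subset\mathbb{Z}^n_{\geqslant}$ be a three-element set of exponent vectors containing the zero vector $\bar 0$. In each $A^{(i)}$ fix an ordered pair of distinct elements $\mu^{(i)},\nu^{(i)}$, and let $\beta^{(i)}$ denote the remaining (third) element of $A^{(i)}$. Let $\varkappa$ be the $n\times n$ matrix with columns $\mu^{(1)}-\nu^{(1)},\dots,\mu^{(n)}-\nu^{(n)}$, and assume $\varkappa$ is nondegenerate. Let $\overline{\beta}$ be the $n\times n$ matrix with columns $\beta^{(i)}-\nu^{(i)}$, $i=1,\dots,n$. Consider the reduced trinomial system $$ r^{(i)}_{\beta^{(i)}}\, y^{\beta^{(i)}} + y^{\mu^{(i)}} - y^{\nu^{(i)}} = 0,\qquad i=1,\dots,n,$$ with unknown $y=(y_1,\dots,y_n)$ and complex variable coefficients $r=(r^{(1)}_{\beta^{(1)}},\dots,r^{(n)}_{\beta^{(n)}})\in\mathbb{C}^n$ (written $r=(r_1,\dots,r_n)$). Let $y(r)$ be its principal solution, i.e. the branch of the algebraic solution with $y_i(0)=1$ for all $i$, and for $d=(d_1,\dots,d_n)\in\mathbb{R}^n_+$ let $y^d(r)=y_1^{d_1}(r)\cdots y_n^{d_n}(r)$. Then, in a neighbourhood of the origin, $y^d(r)$ admits the Taylor series representation $$ y^d(r)=\sum_{k\in\mathbb{Z}^n_{\geqslant}} c_k\, r^k,\qquad r^k=r_1^{k_1}\cdots r_n^{k_n},$$ with coefficients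 $$ c_k=\frac{(-1)^{|k|}}{k!}\,\frac{\Gamma\left(\varkappa^{-1}d+\varkappa^{-1}\overline{\beta}k\right)}{\Gamma\left(\varkappa^{-1}d+\varkappa^{-1}\overline{\beta}k-k+I\right)}\,Q(k),\qquad k\in\mathbb{Z}^n_{\geqslant},$$ where $Q(k)=\det\left(\operatorname{diag}\left[\varkappa^{-1}d+\varkappa^{-1}\overline{\beta}k\right]-\varkappa^{-1}\overline{\beta}\,\operatorname{diag}[k]\right)$.
   Context: $y^\alpha=y_1^{\alpha_1}\cdots y_n^{\alpha_n}$; $\mathbb{Z}^n_{\geqslant}$ denotes vectors with nonnegative integer entries. Powers $y_j^{d_j}$ near $y_j=1$ are taken with the principal branch (equal to $1$ at $y_j=1$). For a vector $b=(b_1,\dots,b_n)$, $\Gamma(b)$ denotes $\prod_{k=1}^n\Gamma(b_k)$, and $\operatorname{diag}[b]$ is the diagonal matrix with $b_1,\dots,b_n$ on the diagonal. $I=(1,\dots,1)$, $k!=k_1!\cdots k_n!$, $|k|=k_1+\dots+k_n$. A ratio of products of Gamma functions is understood as the meromorphic function obtained after removing removable singularities (e.g. $\Gamma(-1)/\Gamma(0)=-1$), so it has a finite value when the arguments hit nonpositive integers.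
   Formalization: Where k_j = 0 and the j-th entry of ϰ⁻¹d + ϰ⁻¹β̄k is 0, the Gamma ratio has a true pole while Q(k) = 0, so the printed c_k is undefined; there c_k is taken as its limit (continuous extension in ϰ⁻¹d), cancelling that entry against column j of the matrix in Q(k). *)

(* Defs.v *)
From HB Require Import structures.
From mathcomp Require Import all_boot all_order all_algebra.
From mathcomp Require Import all_classical all_reals all_analysis.
From mathcomp Require Import complex.

Set Implicit Arguments.
Unset Strict Implicit.
Unset Printing Implicit Defensive.

Import Order.TTheory GRing.Theory Num.Theory.
Local Open Scope ring_scope.
Local Open Scope complex_scope.

Section Defs.
Variable R : realType.

Definition cabs (z : R[i]) : R := Num.sqrt (complex.Re z ^+ 2 + complex.Im z ^+ 2).

(** principal argument, with values in (-pi, pi] *)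
Definition carg (z : R[i]) : R :=
  let x := complex.Re z in let y := complex.Im z in
  if 0 < x then atan (y / x)
  else if x < 0 then (if 0 <= y then atan (y / x) + pi else atan (y / x) - pi)
  else if 0 < y then pi / 2 else if y < 0 then - (pi / 2) else 0.

(** principal branch of z^d for real d : |z|^d * exp(i d Arg z); 0^d := 0
    (only used with d > 0).  It equals 1 at z = 1. *)
Definition cpow (z : R[i]) (d : R) : R[i] :=
  if z == 0 then 0
  else (powR (cabs z) d)%:C * ((cos (d * carg z)) +i* (sin (d * carg z))).

Definition monom n (y : 'I_n -> R[i]) (alpha : 'I_n -> nat) : R[i] :=
  \prod_(j < n) y j ^+ alpha j.

Definition cpowv n (y : 'I_n -> R[i]) (d : 'I_n -> R) : R[i] :=
  \prod_(j < n) cpow (y j) (d j).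

(** Gamma(x) / Gamma(x - m + 1) for m : nat, with removable singularities
    removed: for m >= 1 it is the polynomial (x-1)(x-2)...(x-m+1);
    for m = 0 it is 1/x (a genuine pole at x = 0, see coef below). *)
Definition gamma_ratio (x : R) (m : nat) : R :=
  if m == 0%N then x^-1 else \prod_(1 <= j < m) (x - j%:R).

Definition kappa n (mu nu : 'I_n -> 'I_n -> nat) : 'M[R]_n :=
  \matrix_(j, i) ((mu i j)%:R - (nu i j)%:R).

Definition betabar n (beta nu : 'I_n -> 'I_n -> nat) : 'M[R]_n :=
  \matrix_(j, i) ((beta i j)%:R - (nu i j)%:R).

Definition avec n (mu nu beta : 'I_n -> 'I_n -> nat) (d : 'I_n -> R)
    (k : 'I_n -> nat) : 'cV[R]_n :=
  invmx (kappa mu nu) *m (\col_j d j)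
  + invmx (kappa mu nu) *m betabar beta nu *m (\col_j (k j)%:R).

Definition Qmat n (mu nu beta : 'I_n -> 'I_n -> nat) (d : 'I_n -> R)
    (k : 'I_n -> nat) : 'M[R]_n :=
  diag_mx (avec mu nu beta d k)^T
  - invmx (kappa mu nu) *m betabar beta nu *m diag_mx (\row_j (k j)%:R).

Definition Qdet n (mu nu beta : 'I_n -> 'I_n -> nat) (d : 'I_n -> R)
    (k : 'I_n -> nat) : R := \det (Qmat mu nu beta d k).

(** The coefficient c_k.  When no Gamma ratio hits the pole (i.e. for every j,
    k_j <> 0 or a_j <> 0) this is literally
      (-1)^|k| / k! * prod_j Gamma(a_j)/Gamma(a_j - k_j + 1) * Q(k).
    Otherwise it is the value of the removable singularity of this product:
    for k_j = 0 the j-th column of the matrix in Q(k) is a_j e_j, and the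
    factor 1/a_j is absorbed into that column (multilinearity of det). *)
Definition coef n (mu nu beta : 'I_n -> 'I_n -> nat) (d : 'I_n -> R)
    (k : 'I_n -> nat) : R :=
  let a := avec mu nu beta d k in
  let s := (-1) ^+ (\sum_(j < n) k j) / (\prod_(j < n) (k j)`!%:R) in
  if [forall j : 'I_n, (k j != 0%N) || (a j 0 != 0)] then
    s * (\prod_(j < n) gamma_ratio (a j 0) (k j)) * Qdet mu nu beta d k
  else
    s * \det (\matrix_(i, j) (if k j == 0%N then (i == j)%:R
                              else gamma_ratio (a j 0) (k j)
                                   * Qmat mu nu beta d k i j)).

End Defs.

(* Main.v *)
Require Import Defs.
From HB Require Import structures.
From mathcomp Require Import all_boot all_order all_algebra.
From mathcomp Require Import all_classical all_reals all_analysis.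
From mathcomp Require Import complex.
From mathcomp Require Import perm ring lra zify.

Set Implicit Arguments.
Unset Strict Implicit.
Unset Printing Implicit Defensive.

Import Order.TTheory GRing.Theory Num.Theory.
Local Open Scope ring_scope.
Local Open Scope complex_scope.

(** Put [z_i = y^(mu^(i) - nu^(i))], [B = kappa^-1 betabar], [a = kappa^-1 d].  The
    system becomes [z_i = 1 - r_i z^(B e_i)] and [y^d = z^a], so [c_k] is a
    multivariate Lagrange coefficient, and it makes sense for every real vector
    [a].  Pascal's rule, applied to the one column of the determinant which depends
    on [a_i], gives [c_k(a + e_i) = c_k(a) - c_(k - e_i)(a + B e_i)], while
    [c_k(0) = 0] for [k <> 0].  Let [s_m(a)] be the sum of [c_k(a) r^k] over [|k| = m].
    By induction on [m], the difference
    [\sum_i s_i(a) s_(m-i)(b) - s_m(a+b)] is invariant under [a -> a + e_i]; being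
    polynomial in [a] it is constant, and it vanishes at [a = 0].  Hence
    [S(a) = \sum_m s_m(a)], which converges for small [r] because [c_k(a)] grows at
    most geometrically in [|k|], satisfies [S(a+b) = S(a) S(b)] and
    [S(a + e_i) = S(a) - r_i S(a + B e_i)].  Consequently [Y_j = S(kappa^-1 e_j)]
    solves the trinomial system; as the linearization of the system at
    [y = (1, .., 1)], [r = 0] is the transpose of [kappa], small solutions are unique
    and [Y = y(r)].  Finally [S(t v)] is the principal power [S(v)^t]: their quotient
    is a 1-periodic character of the line with values near 1, hence trivial. *)

(** * Modulus of complex numbers *)

Section ComplexModulus.
Variable R : realType.
Implicit Types z w : R[i].

Lemma cabsE z : cabs z = ComplexField.Normc.normc z.
Proof. by case: z. Qed.

Lemma cabs_ge0 z : 0 <= cabs z. Proof. exact: sqrtr_ge0. Qed.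

Lemma cabs0 : cabs (0 : R[i]) = 0.
Proof. by rewrite cabsE ComplexField.Normc.normc0. Qed.

Lemma cabs1 : cabs (1 : R[i]) = 1.
Proof. by rewrite cabsE ComplexField.Normc.normc1. Qed.

Lemma cabsM z w : cabs (z * w) = cabs z * cabs w.
Proof. by rewrite !cabsE ComplexField.Normc.normcM. Qed.

Lemma cabsX z k : cabs (z ^+ k) = cabs z ^+ k.
Proof. by elim: k => [|k IH]; rewrite ?cabs1 // !exprS cabsM IH. Qed.

Lemma cabsD z w : cabs (z + w) <= cabs z + cabs w.
Proof. by rewrite !cabsE le_normcD. Qed.

Lemma cabsN z : cabs (- z) = cabs z.
Proof. by rewrite !cabsE normcN. Qed.

Lemma cabsB z w : cabs (z - w) <= cabs z + cabs w.
Proof. by rewrite -(cabsN w) cabsD. Qed.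

Lemma cabs_distC z w : cabs (z - w) = cabs (w - z).
Proof. by rewrite -cabsN opprB. Qed.

Lemma cabs_eq0 z : cabs z = 0 -> z = 0.
Proof. by rewrite cabsE => /ComplexField.Normc.eq0_normc. Qed.

Lemma cabs_real (x : R) : cabs x%:C = `|x|.
Proof. by rewrite /cabs /= expr0n addr0 sqrtr_sqr. Qed.

Lemma cabs_nat (k : nat) : cabs (k%:R : R[i]) = k%:R.
Proof. by rewrite -(rmorph_nat (real_complex R)) cabs_real ger0_norm. Qed.

Lemma cabs_sum (I : Type) (r : seq I) (P : pred I) (F : I -> R[i]) :
  cabs (\sum_(i <- r | P i) F i) <= \sum_(i <- r | P i) cabs (F i).
Proof.
elim/big_rec2: _ => [|i y1 y2 _ h]; first by rewrite cabs0.
by apply: le_trans (cabsD _ _) _; rewrite lerD2l.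
Qed.

Lemma cabs_prod (I : Type) (r : seq I) (P : pred I) (F : I -> R[i]) :
  cabs (\prod_(i <- r | P i) F i) = \prod_(i <- r | P i) cabs (F i).
Proof. by rewrite (big_morph _ cabsM cabs1). Qed.

Lemma normRe_le z : `|complex.Re z| <= cabs z.
Proof. by rewrite -sqrtr_sqr ler_wsqrtr// lerDl sqr_ge0. Qed.

Lemma normIm_le z : `|complex.Im z| <= cabs z.
Proof. by rewrite -sqrtr_sqr ler_wsqrtr// lerDr sqr_ge0. Qed.

Lemma cabs_le_ReIm z : cabs z <= `|complex.Re z| + `|complex.Im z|.
Proof.
case: z => a b; rewrite /cabs /=.
rewrite -[leRHS]ger0_norm ?addr_ge0// -sqrtr_sqr ler_wsqrtr//.
rewrite sqrrD !real_normK ?num_real// -addrA lerD2l lerDr.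
by rewrite mulrn_wge0// mulr_ge0.
Qed.

Lemma cabs_eps0 z : (forall e : R, 0 < e -> cabs z <= e) -> z = 0.
Proof.
move=> h; apply: cabs_eq0; apply/eqP; rewrite eq_le cabs_ge0 andbT.
by apply/ler_addgt0Pr => e /h; rewrite add0r.
Qed.

End ComplexModulus.

(** * Binomial coefficients with a real upper argument *)

Section GeneralizedBinomial.
Variable R : realType.
Implicit Types x : R.

Definition gbin x (k : nat) : R := (\prod_(j < k) (x - j%:R)) / k`!%:R.

(** The binomial coefficient of [x - 1] over [k - 1]. For [x != 0] it equals [k / x] times
    [gbin x k]; at [x = 0] the singularity of that quotient is removed. *)
Definition gbin_pred x (k : nat) : R :=
  if k is k'.+1 then gbin (x - 1) k' else 0.

Lemma gbin0 x : gbin x 0 = 1.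
Proof. by rewrite /gbin big_ord0 divr1. Qed.

Lemma fact_neq0 (k : nat) : k`!%:R != 0 :> R.
Proof. by rewrite pnatr_eq0 -lt0n fact_gt0. Qed.

Lemma gbinS x k : gbin x k.+1 = x / k.+1%:R * gbin (x - 1) k.
Proof.
rewrite /gbin big_ord_recl subr0 factS natrM invfM.
under eq_bigr => i _ do rewrite lift0 -natr1 opprD addrA addrAC.
by field; rewrite ?fact_neq0 ?nat1r ?pnatr_eq0.
Qed.

Lemma gbinSr x k : gbin x k.+1 = gbin x k * (x - k%:R) / k.+1%:R.
Proof.
rewrite /gbin big_ord_recr factS natrM invfM /=.
by field; rewrite ?fact_neq0 ?nat1r ?pnatr_eq0.
Qed.

Lemma gbin_pascal x k : gbin (x + 1) k.+1 = gbin x k.+1 + gbin x k.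
Proof.
rewrite gbinS gbinSr addrK -natr1.
by field; rewrite ?fact_neq0 ?nat1r ?pnatr_eq0.
Qed.

(** Each factor satisfies [|x - j| <= N + j + 1], so the product is at most the falling factorial
    [(N + k) ^_ k]; division by [k!] leaves a binomial coefficient, at most [2 ^ (N + k)]. *)
Lemma gbin_bound x (N k : nat) : `|x| <= N%:R -> `|gbin x k| <= 2 ^+ (N + k).
Proof.
move=> xN; rewrite /gbin normrM normrV ?unitfE ?fact_neq0// (@ger0_norm _ k`!%:R)//.
rewrite ler_pdivrMr ?ltr0n ?fact_gt0//.
have h1 : `|\prod_(j < k) (x - j%:R)| <= ((N + k) ^_ k)%:R :> R.
  elim: k => [|k IH]; first by rewrite big_ord0 normr1 ffactn0.
  rewrite big_ord_recr /= normrM addnS ffactSS natrM mulrC ler_pM//.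
  rewrite -addnS natrD; apply: le_trans (ler_normB _ _) _.
  by rewrite lerD// ger0_norm// ler_nat.
apply: le_trans h1 _; rewrite -bin_ffact natrM ler_wpM2r//.
rewrite -natrX ler_nat; move: (N + k)%N => m.
elim: m k => [[|k] //|m IH [|k]]; first by rewrite bin0 expn_gt0.
by rewrite binS expnS mul2n -addnn leq_add.
Qed.

End GeneralizedBinomial.

(** * Lagrange coefficients: recursion, vanishing at zero, growth *)

Section LagrangeCoefficients.
Variables (R : realType) (n : nat) (B : 'M[R]_n).
Implicit Types (a x v : 'cV[R]_n) (k : 'I_n -> nat) (i : 'I_n).

Definition shifted a k : 'cV[R]_n := a + B *m \col_j (k j)%:R.

(** Row [j] is column [j] of the matrix in Q(k) with the Gamma quotient and [1 / k_j!] multiplied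
    in, so that no pole is left. The transposition puts all dependence on [x j] and [k j] into row
    [j], where multilinearity applies. *)
Definition lmat x k : 'M[R]_n :=
  \matrix_(j, i) ((i == j)%:R * gbin (x j 0) (k j) - B i j * gbin_pred (x j 0) (k j)).

(** [lco a k] is the coefficient of [r^k] in [z^a], where
    [z_i = 1 - r_i \prod_j z_j^(B j i)] and [z(0) = 1]. *)
Definition lco a k : R := (-1) ^+ (\sum_j k j) * \det (lmat (shifted a k) k).

Definition kincr i k : 'I_n -> nat := fun j => (k j + (j == i))%N.

Lemma shiftedD a v k : shifted (a + v) k = shifted a k + v.
Proof. by rewrite /shifted addrAC. Qed.

Lemma shifted_incr a k i : shifted a (kincr i k) = shifted (a + col i B) k.
Proof.
rewrite /shifted -addrA; congr (_ + _); apply/colP => l; rewrite !mxE.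
under eq_bigr => j _ do rewrite mxE natrD mulrDr.
rewrite big_split /= addrC; congr (_ + _); last by apply: eq_bigr => j _; rewrite mxE.
rewrite (bigD1 i)//= eqxx mulr1 big1 ?addr0// => j /negbTE ->.
by rewrite mulr0.
Qed.

(** Only row [i] differs among the three matrices, and there both [gbin] and [gbin_pred] obey
    Pascal's rule. *)
Lemma det_lmat_incr x k i :
  \det (lmat (x + delta_mx i 0) (kincr i k)) =
  \det (lmat x (kincr i k)) + \det (lmat x k).
Proof.
rewrite -[\det (lmat x _)]mul1r -[\det (lmat x k)]mul1r.
apply: (@determinant_multilinear _ _ _ _ _ i).
- apply/rowP => j; rewrite !scale1r !mxE !eqxx /= /kincr eqxx addn1 gbin_pascal.
  (* At [k i = 0] the rule for [gbin_pred] reads [1 = 1 + 0], thanks to the value 0 of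
     [gbin_pred x 0]. *)
  case: (k i) => [|q] /=; first by rewrite !gbin0; ring.
  by rewrite addrK -[in gbin (x i 0) q.+1](subrK 1 (x i 0)) gbin_pascal; ring.
- apply/matrixP => l j; rewrite !mxE.
  by rewrite [lift i l == i]eq_sym (negbTE (neq_lift i l)) /= addr0.
- apply/matrixP => l j; rewrite !mxE /kincr.
  by rewrite [lift i l == i]eq_sym (negbTE (neq_lift i l)) /= addr0 addn0.
Qed.

Lemma lco_incr a k i :
  lco (a + delta_mx i 0) (kincr i k) = lco a (kincr i k) - lco (a + col i B) k.
Proof.
have sk : (\sum_j kincr i k j = (\sum_j k j).+1)%N.
  rewrite big_split /= -addn1; congr addn.
  by rewrite (bigD1 i)//= eqxx big1 // => j /negbTE ->.
by rewrite /lco shiftedD det_lmat_incr -shifted_incr sk exprS; ring.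
Qed.

(** When [k i = 0], row [i] of [lmat] is a unit row, so the coordinate [i] of the argument does not
    occur. *)
Lemma lco_eq0 a k i : k i = 0%N -> lco (a + delta_mx i 0) k = lco a k.
Proof.
move=> ki; rewrite /lco shiftedD; congr (_ * \det _).
apply/matrixP => j l; rewrite !mxE eqxx andbT.
by case: (eqVneq j i) => [->|_]; rewrite ?addr0// ki !gbin0.
Qed.

Lemma lco_k0 a k : (forall i, k i = 0%N) -> lco a k = 1.
Proof.
move=> k0; rewrite /lco big1// mul1r.
rewrite [lmat _ _](_ : _ = 1%:M) ?det1//.
by apply/matrixP => j l; rewrite !mxE k0 gbin0 mulr0 subr0 mulr1 eq_sym.
Qed.

(** With [x = B k], the columns of [diag x - B diag k] add up to the zero vector. *)
Lemma lco_0 k i : k i != 0%N -> lco 0 k = 0.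
Proof.
move=> ki; rewrite /lco; set x := shifted 0 k.
(* [U] is diag x - B diag k with each column [x_j e_j] belonging to [k j = 0] replaced by [e_j]; [w]
   holds the factors relating its columns to the rows of [lmat]. *)
pose U : 'M[R]_n := \matrix_(l, j)
  (if k j == 0%N then (l == j)%:R else x j 0 *+ (l == j) - B l j * (k j)%:R).
pose w : 'rV[R]_n := \row_j
  (if k j is q.+1 then gbin (x j 0 - 1) q / q.+1%:R else 1).
have -> : lmat x k = diag_mx w *m U^T.
  apply/matrixP => j l; rewrite mul_diag_mx !mxE.
  case: (k j) => [|q]; first by rewrite gbin0 mulr0 mulr1 mul1r subr0.
  rewrite gbinS /= -mulr_natl; field; by rewrite nat1r pnatr_eq0.
rewrite det_mulmx det_tr (_ : \det U = 0) ?mulr0//.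
apply/eqP; rewrite -det_tr; apply/det0P.
(* The weight [x j] restores the replaced columns, so the weighted sum is zero; coordinate [i] of
   the weights is 1, hence they are not all zero. *)
exists (\row_j (if k j == 0%N then x j 0 else 1)).
  apply/eqP => /rowP /(_ i); rewrite !mxE (negbTE ki) => /eqP.
  by rewrite oner_eq0.
apply/rowP => l; rewrite !mxE.
transitivity (\sum_j (x j 0 *+ (l == j) - B l j * (k j)%:R)).
  apply: eq_bigr => j _; rewrite !mxE; case: eqP => [->|_]; last by rewrite mul1r.
  by rewrite mulr0 subr0 mulr_natr.
rewrite sumrB (bigD1 l)//= eqxx big1 ?addr0 => [|j /negbTE jl]; last by rewrite eq_sym jl.
rewrite /x /shifted add0r mxE mulr1n -sumrB big1// => j _.
by rewrite mxE subrr.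
Qed.

Lemma det_bound (M : 'M[R]_n) (c : R) :
  (forall i j, `|M i j| <= c) -> `|\det M| <= n`!%:R * c ^+ n.
Proof.
move=> Mc; rewrite /determinant; apply: le_trans (ler_norm_sum _ _ _) _.
have -> : n`!%:R * c ^+ n = \sum_(s : 'S_n) c ^+ n.
  by rewrite sumr_const card_Sn mulr_natl.
apply: ler_sum => s _; rewrite normrM normrX normrN1 expr1n mul1r normr_prod.
apply: le_trans (_ : \prod_(j < n) c <= _); last by rewrite prodr_const card_ord.
by apply: ler_prod => j _; rewrite normr_ge0 Mc.
Qed.

(** The shifted argument is at most [A + b |k|] in absolute value, so by [gbin_bound] each entry is
    at most exponential in [|k|], and the determinant involves products of only [n] entries. *)
Lemma lco_bound (b A : nat) a k :
  (forall i j, `|B i j| <= b%:R) -> (forall i, `|a i 0| <= A%:R) ->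
  `|lco a k| <= (n`! * ((b.+1 * 2 ^ A.+1) ^ n))%:R * (2 ^ (b.+1 * n))%:R ^+ (\sum_j k j).
Proof.
move=> Bb aA; set m := (\sum_j k j)%N.
have xb i : `|shifted a k i 0| <= (A + b * m)%:R.
  rewrite /shifted !mxE natrD; apply: le_trans (ler_normD _ _) _; rewrite lerD//.
  apply: le_trans (ler_norm_sum _ _ _) _; rewrite natrM /m natr_sum mulr_sumr.
  by apply: ler_sum => j _; rewrite mxE normrM [`|(k j)%:R|]ger0_norm// ler_wpM2r.
have km i : (k i <= m)%N by rewrite /m (bigD1 i)//= leq_addr.
rewrite /lco normrM normrX normrN1 expr1n mul1r.
(* The factor [b.+1] counts the diagonal 1 and the entry of [B]; the exponent absorbs [A + b * m],
   the order [k j <= m] and the shift by 1 in [gbin_pred]. *)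
set c := (b.+1 * 2 ^ (A.+1 + b.+1 * m))%N.
have -> : (n`! * (b.+1 * 2 ^ A.+1) ^ n)%:R * (2 ^ (b.+1 * n))%:R ^+ m =
   n`!%:R * c%:R ^+ n :> R.
  rewrite -natrX -natrM -natrX -natrM /c; congr (_%:R); rewrite -mulnA; congr muln.
  by rewrite expnD mulnA [RHS]expnMn -!expnM; congr muln; congr expn; ring.
apply: det_bound => j i; rewrite [lmat _ _ _ _]mxE /c.
have g1 : `|gbin (shifted a k j 0) (k j)| <= (2 ^ (A.+1 + b.+1 * m))%:R.
  apply: le_trans (gbin_bound _ (xb j)) _.
  rewrite -natrX ler_nat leq_pexp2l//; move: (km j); lia.
have g2 : `|gbin_pred (shifted a k j 0) (k j)| <= (2 ^ (A.+1 + b.+1 * m))%:R.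
  move: (km j); case: (k j) => [|q] qm; first by rewrite /= normr0.
  have h : `|shifted a k j 0 - 1| <= (A + b * m).+1%:R.
    by apply: le_trans (ler_normB _ _) _; rewrite normr1 -natr1 lerD2r.
  apply: le_trans (gbin_bound _ h) _.
  rewrite -natrX ler_nat leq_pexp2l//; move: qm; lia.
move: g1 g2; move: (gbin _ _) (gbin_pred _ _) => G1 G2 g1 g2.
apply: le_trans (ler_normB _ _) _; rewrite !normrM mulSn natrD natrM lerD// ?ler_pM//.
by case: eqP => _; rewrite ?normr1 ?mul1r ?normr0 ?mul0r.
Qed.

End LagrangeCoefficients.

(** * Polynomial dependence on the vector argument *)

Section PolynomialAlongLines.
Variables (R : realType) (n : nat).
Implicit Types (a v : 'cV[R]_n) (f g : 'cV[R]_n -> R[i]).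

(** Polynomiality is tested along real lines only: this is stable under sums, products and
    translations, and suffices to exploit periodicity. *)
Definition line_poly f :=
  forall a v, exists p : {poly R[i]}, forall t : R, f (a + t *: v) = p.[t%:C].

Lemma line_poly_cst c : line_poly (fun _ => c).
Proof. by move=> a v; exists c%:P => t; rewrite hornerC. Qed.

Lemma line_polyD f g : line_poly f -> line_poly g -> line_poly (fun a => f a + g a).
Proof.
move=> hf hg a v; have [p hp] := hf a v; have [q hq] := hg a v.
by exists (p + q) => t; rewrite hornerD hp hq.
Qed.

Lemma line_polyM f g : line_poly f -> line_poly g -> line_poly (fun a => f a * g a).
Proof.
move=> hf hg a v; have [p hp] := hf a v; have [q hq] := hg a v.
by exists (p * q) => t; rewrite hornerM hp hq.
Qed.

Lemma line_polyB f g : line_poly f -> line_poly g -> line_poly (fun a => f a - g a).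
Proof.
move=> hf hg a v; have [p hp] := hf a v; have [q hq] := hg a v.
by exists (p - q) => t; rewrite hornerD hornerN hp hq.
Qed.

Lemma line_poly_sum (I : Type) (r : seq I) (P : pred I) (F : I -> 'cV[R]_n -> R[i]) :
  (forall i, P i -> line_poly (F i)) -> line_poly (fun a => \sum_(i <- r | P i) F i a).
Proof.
move=> h; elim: r => [|i r IH].
  by move=> a v; exists 0 => t; rewrite big_nil horner0.
case Pi : (P i) => a v.
  have [p hp] := line_polyD (h i Pi) IH a v.
  by exists p => t; rewrite big_cons Pi hp.
by have [p hp] := IH a v; exists p => t; rewrite big_cons Pi hp.
Qed.

Lemma line_poly_prod (I : Type) (r : seq I) (F : I -> 'cV[R]_n -> R[i]) :
  (forall i, line_poly (F i)) -> line_poly (fun a => \prod_(i <- r) F i a).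
Proof.
move=> h; elim: r => [|i r IH] a v.
  by exists 1 => t; rewrite big_nil hornerC.
have [p hp] := line_polyM (h i) IH a v.
by exists p => t; rewrite big_cons hp.
Qed.

Lemma line_poly_coord j : line_poly (fun a => (a j 0)%:C).
Proof.
move=> a v; exists ((a j 0)%:C%:P + (v j 0)%:C *: 'X) => t.
by rewrite !mxE rmorphD rmorphM /= hornerD hornerC hornerZ hornerX mulrC.
Qed.

Lemma line_poly_shift f v : line_poly f -> line_poly (fun a => f (a + v)).
Proof.
move=> h a w; have [p hp] := h (a + v) w.
by exists p => t; rewrite addrAC hp.
Qed.

Lemma line_poly_gbin j k : line_poly (fun a => (gbin (a j 0) k)%:C).
Proof.
suff : line_poly (fun a => (\prod_(i < k) ((a j 0)%:C - i%:R)) * (k`!%:R^-1)).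
  move=> h a v; have [p hp] := h a v; exists p => t; rewrite -hp /gbin.
  rewrite rmorphM fmorphV rmorph_nat rmorph_prod; congr (_ * _).
  by apply: eq_bigr => i _; rewrite rmorphB rmorph_nat.
apply: line_polyM; last exact: line_poly_cst.
apply: line_poly_prod => i; apply: line_polyB; last exact: line_poly_cst.
exact: line_poly_coord.
Qed.

Lemma line_poly_gbin_pred j k : line_poly (fun a => (gbin_pred (a j 0) k)%:C).
Proof.
case: k => [|k] /=; first exact: line_poly_cst.
move=> a v; have [p hp] := line_poly_shift (- const_mx 1) (line_poly_gbin j k) a v.
by exists p => t; rewrite -hp !mxE.
Qed.

Lemma line_poly_lco (B : 'M[R]_n) k : line_poly (fun a => (lco B a k)%:C).
Proof.
suff : line_poly (fun x => (\det (lmat B x k))%:C).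
  move=> h a v.
  have [p hp] := line_polyM (line_poly_cst ((-1) ^+ (\sum_j k j)))
    (line_poly_shift (B *m \col_j (k j)%:R) h) a v.
  by exists p => t; rewrite -hp /lco rmorphM rmorphXn rmorphN1.
suff : line_poly (fun x => \sum_(s : 'S_n) (-1) ^+ s * \prod_j
    (((s j == j)%:R : R)%:C * (gbin (x j 0) (k j))%:C
      - (B (s j) j)%:C * (gbin_pred (x j 0) (k j))%:C)).
  move=> h a v; have [p hp] := h a v; exists p => t; rewrite -hp /determinant rmorph_sum.
  apply: eq_bigr => s _; rewrite rmorphM rmorphXn rmorphN1 rmorph_prod.
  by congr (_ * _); apply: eq_bigr => j _; rewrite !mxE rmorphB !rmorphM.
apply: line_poly_sum => s _; apply: line_polyM; first exact: line_poly_cst.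
apply: line_poly_prod => j; apply: line_polyB.
  by apply: line_polyM; [exact: line_poly_cst | exact: line_poly_gbin].
by apply: line_polyM; [exact: line_poly_cst | exact: line_poly_gbin_pred].
Qed.

(** Along [e_i] the polynomial takes one value at all natural numbers, so it is constant; moving one
    coordinate at a time joins [0] to [a]. *)
Lemma line_poly_periodic f :
  line_poly f -> (forall a i, f (a + delta_mx i 0) = f a) -> forall a, f a = f 0.
Proof.
move=> hf per a.
have step b i (t : R) : f (b + t *: delta_mx i 0) = f b.
  have [p hp] := hf b (delta_mx i 0).
  have pn (m : nat) : p.[m%:R] = f b.
    rewrite -(rmorph_nat (real_complex R)) -hp.
    elim: m => [|m IH]; first by rewrite scale0r addr0.
    by rewrite -natr1 scalerDl scale1r addrA per.
  suff pE : p = (f b)%:P by rewrite hp pE hornerC.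
  apply/eqP; rewrite -subr_eq0; apply/eqP.
  apply: (@roots_geq_poly_eq0 _ _ [seq m%:R | m <- iota 0 (size (p - (f b)%:P)).+1]).
  - by apply/allP => _ /mapP[m _ ->]; rewrite /root hornerD hornerN hornerC pn subrr.
  - rewrite map_inj_uniq ?iota_uniq// => m q /eqP.
    by rewrite eqr_nat => /eqP.
  - by rewrite size_map size_iota.
have path (r : seq 'I_n) b : f (b + \sum_(i <- r) a i 0 *: delta_mx i 0) = f b.
  elim: r b => [|i r IH] b; first by rewrite big_nil addr0.
  by rewrite big_cons addrA IH step.
rewrite -(path (index_enum _) 0) add0r {1}[a]matrix_sum_delta.
by congr f; apply: eq_bigr => i _; rewrite big_ord1.
Qed.

End PolynomialAlongLines.

(** * The Gamma formula as a Lagrange coefficient *)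

Section CoefIsLagrange.
Variables (R : realType) (n : nat) (mu nu beta : 'I_n -> 'I_n -> nat).

Lemma QmatE (d : 'I_n -> R) (k : 'I_n -> nat) i j :
  Qmat mu nu beta d k i j = avec mu nu beta d k j 0 *+ (i == j)
    - (invmx (kappa R mu nu) *m betabar R beta nu) i j * (k j)%:R.
Proof.
rewrite /Qmat mul_mx_diag; move: (avec _ _ _ _ _) (_ *m _) => a B.
by rewrite !mxE; case: eqP => [->|].
Qed.

(** Both branches of [coef] equal the sign times [\det N / \prod_j k_j!], and the columns of [N] are
    the rows of [lmat] multiplied by [k_j!]. *)
Lemma coef_lco (d : 'I_n -> R) (k : 'I_n -> nat) :
  coef mu nu beta d k =
  lco (invmx (kappa R mu nu) *m betabar R beta nu)
      (invmx (kappa R mu nu) *m \col_j d j) k.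
Proof.
rewrite /coef /lco (_ : shifted _ _ k = avec mu nu beta d k) //.
set N := \matrix_(i, j) (if _ then _ else _).
have NE i j : N i j = if k j == 0%N then (i == j)%:R
    else gamma_ratio (avec mu nu beta d k j 0) (k j) * Qmat mu nu beta d k i j.
  by rewrite [LHS]mxE.
have QE := QmatE d k.
move: N NE QE; rewrite /Qdet; move: (Qmat _ _ _ _ _) (avec _ _ _ _ _) (_ *m _).
move=> Q a B N NE QE.
have detN : \det N = (\prod_j (k j)`!%:R) * \det (lmat B a k).
  have -> : N = (diag_mx (\row_j (k j)`!%:R) *m lmat B a k)^T.
    apply/matrixP => i j; rewrite mxE mul_diag_mx NE QE !mxE.
    case: (k j) => [|q] /=; first by rewrite gbin0 mulr0 subr0 mulr1 mul1r.
    rewrite gbinS factS natrM; set G := gamma_ratio _ _.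
    have -> : G = gbin (a j 0 - 1) q * q`!%:R.
      rewrite /G /gamma_ratio /= /gbin divfK ?fact_neq0// big_add1 /= big_mkord.
      by apply: eq_bigr => l _; rewrite -natr1; ring.
    by rewrite -mulr_natl; field; rewrite nat1r pnatr_eq0.
  rewrite det_tr det_mulmx det_diag; congr (_ * _).
  by apply: eq_bigr => j _; rewrite mxE.
have kf : \prod_j (k j)`!%:R != 0 :> R by apply/prodf_neq0 => j _; exact: fact_neq0.
case: ifP => [/forallP h|_]; last by rewrite detN mulrA divfK.
rewrite -mulrA (_ : _ * \det Q = \det N); first by rewrite detN mulrA divfK.
(* A column of [Q] with [k j = 0] is [a_j e_j]; its factor [1 / a_j] turns it into [e_j], since the
   branch condition gives [a_j != 0]. *)
have -> : N = Q *m diag_mx (\row_j gamma_ratio (a j 0) (k j)).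
  apply/matrixP => i j; rewrite mul_mx_diag !mxE NE mulrC; case: eqP => // kj.
  have := h j; rewrite QE kj /= mulr0 subr0 /gamma_ratio /= => aj.
  by case: (i == j); rewrite ?mulr0n ?mul0r// mulr1n mulfV.
rewrite det_mulmx det_diag mulrC; congr (_ * _).
by apply: eq_bigr => j _; rewrite mxE.
Qed.

End CoefIsLagrange.

(** * Reindexing sums over multi-indices of fixed degree *)

Section SumsOverBoxes.
Variables (V : nmodType) (n : nat).
Implicit Types (F : ('I_n -> nat) -> V) (i : 'I_n).

Lemma le_sum_coord (k : 'I_n -> nat) i : (k i <= \sum_j k j)%N.
Proof. by rewrite (bigD1 i)//= leq_addr. Qed.

(** Degree [m] forces every [k j <= m], so all large enough boxes contain the same such indices. *)
Lemma box_widen F (N N' m : nat) : (m <= N)%N -> (m <= N')%N ->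
  \sum_(k : {ffun 'I_n -> 'I_N.+1} | (\sum_j k j)%N == m) F (fun j => k j) =
  \sum_(k : {ffun 'I_n -> 'I_N'.+1} | (\sum_j k j)%N == m) F (fun j => k j).
Proof.
move=> mN mN'.
pose h M M' (k : {ffun 'I_n -> 'I_M.+1}) : {ffun 'I_n -> 'I_M'.+1} := [ffun j => inord (k j)].
have hE M M' (k : {ffun 'I_n -> 'I_M.+1}) :
    (\sum_j k j <= M')%N -> forall j, h M M' k j = k j :> nat.
  by move=> kM j; rewrite ffunE inordK// ltnS (leq_trans (le_sum_coord (fun l => k l) j) kM).
have hK M M' (k : {ffun 'I_n -> 'I_M.+1}) : (\sum_j k j <= M')%N -> h M' M (h M M' k) = k.
  move=> kM; apply/ffunP => j; apply/val_inj => /=.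
  by rewrite ffunE hE// inordK.
have hS M M' (k : {ffun 'I_n -> 'I_M.+1}) :
    (\sum_j k j <= M')%N -> ((\sum_j h M M' k j) = (\sum_j k j))%N.
  by move=> kM; apply: eq_bigr => j _; rewrite hE.
rewrite (reindex_onto (h N' N) (h N N')) => [|k /eqP kM]; last by apply: hK; rewrite kM.
apply: eq_big => [k|k /andP[/eqP k1 /eqP k2]].
  apply/andP/eqP => [[/eqP k1 /eqP k2]|kM]; last first.
    by split; apply/eqP; [rewrite hS kM | apply: hK; rewrite kM].
  by rewrite -k2 hS k1.
congr F; apply/funext => j.
by rewrite -[in RHS]k2 [RHS]hE ?k1.
Qed.

(** Adding [e_i] is a bijection from degree [m] onto the indices of degree [m.+1] with [k i != 0];
    [m < N] keeps it inside the box. *)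
Lemma box_shift F (N m : nat) i : (m < N)%N ->
  \sum_(k : {ffun 'I_n -> 'I_N.+1} | ((\sum_j k j)%N == m.+1) && (k i != 0 :> nat))
     F (fun j => k j) =
  \sum_(k : {ffun 'I_n -> 'I_N.+1} | (\sum_j k j)%N == m) F (kincr i (fun j => k j)).
Proof.
move=> mN.
have sI (k : 'I_n -> nat) : (\sum_j kincr i k j = (\sum_j k j).+1)%N.
  rewrite big_split /= -addn1; congr addn.
  by rewrite (bigD1 i)//= eqxx big1 // => j /negbTE ->.
pose h (k : {ffun 'I_n -> 'I_N.+1}) : {ffun 'I_n -> 'I_N.+1} :=
  [ffun j => inord (kincr i (fun l => k l) j)].
pose h' (k : {ffun 'I_n -> 'I_N.+1}) : {ffun 'I_n -> 'I_N.+1} :=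
  [ffun j => inord (k j - (j == i))].
have h'E k j : h' k j = (k j - (j == i))%N :> nat.
  by rewrite ffunE inordK// ltnS (leq_trans (leq_subr _ _))// -ltnS.
have hE (k : {ffun 'I_n -> 'I_N.+1}) : (\sum_j k j <= m)%N -> forall j, h k j = kincr i (fun l => k l) j :> nat.
  move=> km j; rewrite ffunE inordK// ltnS /kincr.
  have := leq_trans (le_sum_coord (fun l => k l) j) km.
  by case: (j == i) => /=; lia.
have hh' (k : {ffun 'I_n -> 'I_N.+1}) : k i != 0 :> nat ->
    forall j, kincr i (fun l => h' k l) j = k j.
  move=> ki j; rewrite /kincr h'E; case: eqP => [->|_]; last by lia.
  by move: ki; lia.
rewrite (reindex_onto h h') => [|k /andP[/eqP km ki]]; last first.
  by apply/ffunP => j; apply/val_inj; rewrite ffunE hh'// inord_val.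
apply: eq_big => [k|k /andP[/andP[/eqP k1 ki] /eqP k2]].
- apply/idP/eqP => [/andP[/andP[/eqP k1 ki] /eqP k2]|km].
    apply/eqP; rewrite -eqSS -sI -k1; apply/eqP; apply: eq_bigr => j _.
    by rewrite -[in LHS]k2 hh'.
  have hk := hE k (eq_leq km).
  rewrite (eq_bigr _ (fun j _ => hk j)) sI km eqxx hk /kincr eqxx addn1 /=.
  apply/eqP/ffunP => j; apply/val_inj; rewrite /= h'E hk /kincr.
  by rewrite addnK.
congr F; apply/funext => j.
by rewrite -[in RHS]k2 hh'.
Qed.

End SumsOverBoxes.

(** * Homogeneous parts of the series and their addition law *)

Section HomogeneousParts.
Variables (R : realType) (n : nat) (B : 'M[R]_n) (r : 'I_n -> R[i]).
Implicit Types (a v : 'cV[R]_n) (k : 'I_n -> nat) (i : 'I_n).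

Definition lterm a k : R[i] := (lco B a k)%:C * monom r k.

(** This is s_m(a); the box of side [m.+1] contains every index of degree [m]. *)
Definition hpart m a : R[i] :=
  \sum_(k : {ffun 'I_n -> 'I_m.+1} | (\sum_j k j)%N == m) lterm a (fun j => k j).

Lemma hpartE N m a : (m <= N)%N ->
  hpart m a = \sum_(k : {ffun 'I_n -> 'I_N.+1} | (\sum_j k j)%N == m) lterm a (fun j => k j).
Proof. by move=> mN; rewrite /hpart (box_widen (lterm a) (leqnn m) mN). Qed.

Lemma monom_incr k i : monom r (kincr i k) = r i * monom r k.
Proof.
rewrite /monom (bigD1 i)//= [in RHS](bigD1 i)//= /kincr eqxx addn1 exprS -mulrA.
by congr (_ * (_ * _)); apply: eq_bigr => j /negbTE ->; rewrite addn0.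
Qed.

(** Terms with [k i = 0] are unchanged by [lco_eq0]; the others have the form [kincr i k], where
    [lco_incr] applies. *)
Lemma hpart_incr m a i :
  hpart m.+1 (a + delta_mx i 0) = hpart m.+1 a - r i * hpart m (a + col i B).
Proof.
rewrite [hpart m _](hpartE _ (leqnSn m)) /hpart.
rewrite (bigID (fun k : {ffun 'I_n -> 'I_m.+2} => k i != 0 :> nat)) /=.
rewrite [X in X - _](bigID (fun k : {ffun 'I_n -> 'I_m.+2} => k i != 0 :> nat)) /=.
rewrite (box_shift (lterm (a + delta_mx i 0)) i (ltnSn m)).
rewrite (box_shift (lterm a) i (ltnSn m)).
rewrite mulr_sumr addrAC -sumrB; congr (_ + _); apply: eq_bigr => k.
  by move=> _; rewrite /lterm lco_incr monom_incr rmorphB /=; ring.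
by move=> /andP[_ /negPn/eqP ki]; rewrite /lterm lco_eq0.
Qed.

Lemma hpart0 a : hpart 0 a = 1.
Proof.
rewrite /hpart (bigD1 [ffun => ord0]) /=; last by rewrite big1// => j _; rewrite ffunE.
rewrite big1 ?addr0 => [|k /andP[_ /eqP[]]]; last first.
  by apply/ffunP => j; apply/val_inj; rewrite ffunE /=; case: (k j) => -[].
rewrite /lterm lco_k0 => [|j]; last by rewrite ffunE.
by rewrite mul1r /monom big1// => j _; rewrite ffunE.
Qed.

Lemma hpartS_0 m : hpart m.+1 0 = 0.
Proof.
rewrite /hpart big1// => k /eqP km.
have [i ki] : exists i, k i != 0 :> nat.
  apply: contrapT => /forallNP k0; move: km.
  by rewrite big1 // => j _; apply/eqP/negPn/negP/k0.
by rewrite /lterm (lco_0 B (k := fun j => k j) (i := i) ki) mul0r.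
Qed.

Lemma line_poly_hpart m : line_poly (hpart m).
Proof.
apply: line_poly_sum => k _; apply: line_polyM; last exact: line_poly_cst.
exact: line_poly_lco.
Qed.

Lemma hpartD m a v : \sum_(i < m.+1) hpart i a * hpart (m - i) v = hpart m (a + v).
Proof.
elim: m a v => [|m IH] a v; first by rewrite big_ord1 !hpart0 mulr1.
pose D x := \sum_(i < m.+2) hpart i x * hpart (m.+1 - i) v - hpart m.+1 (x + v).
have D0 : D 0 = 0.
  rewrite /D add0r big_ord_recl hpart0 mul1r subn0 big1 ?addr0 ?subrr// => i _.
  by rewrite lift0 hpartS_0 mul0r.
suff : D a = D 0 by rewrite D0 => /eqP; rewrite subr_eq0 => /eqP.
apply: line_poly_periodic => [|x i].
  apply: line_polyB; last exact: line_poly_shift (line_poly_hpart _).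
  apply: line_poly_sum => i _; apply: line_polyM; last exact: line_poly_cst.
  exact: line_poly_hpart.
(* The increment subtracts from the two terms of [D] the two sides of the degree [m] identity at
   [x + col i B], times [r i]; they agree by [IH]. *)
rewrite /D [x + delta_mx i 0 + v]addrAC hpart_incr.
rewrite [in LHS]big_ord_recl [in RHS]big_ord_recl !hpart0.
under eq_bigr => j _ do rewrite lift0 subSS hpart_incr mulrBl -mulrA.
rewrite sumrB -mulr_sumr IH -[x + v + _]addrA [v + _]addrC addrA.
under [in RHS]eq_bigr => j _ do rewrite lift0 subSS.
by ring.
Qed.

Section Bounds.
Variables (b A : nat) (rho : R).
Hypotheses (Bb : forall i j, `|B i j| <= b%:R).
Hypothesis rrho : forall i, cabs (r i) <= rho.

Definition lco_cst : R := (n`! * ((b.+1 * 2 ^ A.+1) ^ n))%:R.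
Definition lco_rate : R := (2 ^ (b.+1 * n))%:R * rho.

Lemma lterm_bound a k : (forall i, `|a i 0| <= A%:R) ->
  cabs (lterm a k) <= lco_cst * lco_rate ^+ (\sum_j k j).
Proof.
move=> aA; rewrite /lterm cabsM cabs_real /lco_rate exprMn mulrA ler_pM ?cabs_ge0//.
  exact: lco_bound.
rewrite /monom cabs_prod expr_sum; apply: ler_prod => i _.
by rewrite cabs_ge0 cabsX lerXn2r ?nnegrE ?cabs_ge0// (le_trans _ (rrho i)) ?cabs_ge0.
Qed.

(** The box has [(m + 1) ^ n] points and [m + 1 <= 2 ^ m], so counting them costs a factor [2 ^ n]
    in the ratio. *)
Lemma hpart_bound m a : (0 < n)%N -> (forall i, `|a i 0| <= A%:R) ->
  cabs (hpart m a) <= lco_cst * ((2 ^ n)%:R * lco_rate) ^+ m.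
Proof.
move=> n0 aA; apply: le_trans (cabs_sum _ _ _) _.
have Q0 : 0 <= lco_rate.
  by rewrite mulr_ge0// (le_trans _ (rrho (Ordinal n0))) ?cabs_ge0.
apply: le_trans (_ : \sum_(k : {ffun 'I_n -> 'I_m.+1}) lco_cst * lco_rate ^+ m <= _).
  rewrite [leRHS](bigID (fun k : {ffun 'I_n -> 'I_m.+1} => (\sum_j k j)%N == m)) /=.
  rewrite -[leLHS]addr0 lerD ?sumr_ge0// => [|k _]; last by rewrite mulr_ge0 ?exprn_ge0.
  apply: ler_sum => k /eqP km.
  by have := lterm_bound (fun j => k j) aA; rewrite km.
rewrite sumr_const card_ffun !card_ord -[leLHS]mulr_natr -mulrA ler_wpM2l//.
rewrite [leRHS]exprMn [leLHS]mulrC ler_wpM2r ?exprn_ge0// -natrX ler_nat -expnM mulnC expnM.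
by rewrite leq_exp2r// ltn_expl.
Qed.

End Bounds.
End HomogeneousParts.

(** * Geometrically convergent series and Cauchy products *)

Section GeometricSeries.
Variable R : realType.
Implicit Types (u v : nat -> R[i]) (p K e : R).

Lemma expr_half_small K e : 0 < e -> exists N0, forall N, (N0 <= N)%N -> K * 2^-1 ^+ N <= e.
Proof.
move=> e0.
have [N0 hN0] : exists N0 : nat, `|K| / e <= N0%:R.
  by exists (Num.bound (`|K| / e)); rewrite ltW// archi_boundP// divr_ge0// ltW.
exists N0 => N NN; apply: le_trans (_ : `|K| * 2^-1 ^+ N <= _).
  by rewrite ler_wpM2r ?ler_norm// exprn_ge0.
rewrite exprVn ler_pdivrMr ?exprn_gt0//.
rewrite mulrC -ler_pdivrMr//; apply: le_trans hN0 _.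
rewrite -natrX ler_nat (leq_trans NN)// ltnW// ltn_expl//.
Qed.

Lemma cabs_le_half_eq0 (z : R[i]) K : (forall N, cabs z <= K * 2^-1 ^+ N) -> z = 0.
Proof.
move=> h; apply: cabs_eps0 => e e0; have [N hN] := expr_half_small K e0.
by apply: le_trans (h N) _; exact: hN.
Qed.

Lemma sum_half_le2 N : \sum_(i < N) 2^-1 ^+ i <= 2 :> R.
Proof.
suff -> : \sum_(i < N) 2^-1 ^+ i = 2 - 2 * 2^-1 ^+ N :> R by rewrite gerBl mulr_ge0 ?exprn_ge0.
elim: N => [|N IH]; first by rewrite big_ord0 mulr1 subrr.
by rewrite big_ord_recr /= IH exprS; field.
Qed.

(** Since [p <= 1/2], the intervals of radius [2 * K * p ^+ N] around the partial sums are nested;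
    the limit is the supremum of their left ends. *)
Lemma real_geo_lim (u : nat -> R) K p : 0 <= p <= 2^-1 -> (forall m, `|u m| <= K * p ^+ m) ->
  exists L, forall N, `|\sum_(m < N) u m - L| <= 2 * K * p ^+ N.
Proof.
move=> /andP[p0 p2] uK; set s := fun N => \sum_(m < N) u m.
have K0 : 0 <= K by have := uK 0; rewrite expr0 mulr1; exact: le_trans.
have step N : `|s N.+1 - s N| + 2 * K * p ^+ N.+1 <= 2 * K * p ^+ N.
  rewrite /s big_ord_recr /= addrAC subrr add0r; apply: le_trans (lerD (uK N) (lexx _)) _.
  rewrite exprS; have := exprn_ge0 N p0; set q := p ^+ N => q0.
  have : 0 <= K * q * (1 - p * 2) by rewrite !mulr_ge0//; lra.
  by lra.
have mono N M : (N <= M)%N ->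
    s N - 2 * K * p ^+ N <= s M - 2 * K * p ^+ M /\ s M + 2 * K * p ^+ M <= s N + 2 * K * p ^+ N.
  move=> /subnK <-; elim: (M - N)%N => [|l [IH1 IH2]]; first by rewrite !lexx.
  rewrite addSn; have := step (l + N)%N => h.
  have := ler_norm (s (l + N).+1 - s (l + N)%N).
  have := ler_norm (- (s (l + N).+1 - s (l + N)%N)); rewrite normrN => h1 h2.
  by split; lra.
pose E := [set s N - 2 * K * p ^+ N | N in [set: nat]]%classic.
have ub N : ubound E (s N + 2 * K * p ^+ N).
  move=> _ [M _ <-]; have [h1 _] := mono M (maxn M N) (leq_maxl _ _).
  have [_ h2] := mono N (maxn M N) (leq_maxr _ _).
  have : 0 <= K * p ^+ maxn M N by rewrite mulr_ge0 ?exprn_ge0.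
  by lra.
have hE : has_sup E by split; [exists (s 0 - 2 * K * p ^+ 0), 0%N | exists (s 0 + 2 * K * p ^+ 0)].
exists (sup E) => N.
have h1 : s N - 2 * K * p ^+ N <= sup E by apply: sup_upper_bound => //; exists N.
have h2 : sup E <= s N + 2 * K * p ^+ N.
  by apply: ge_sup => //; case: hE.
by rewrite ler_norml; apply/andP; split; rewrite -/(s N); lra.
Qed.

Lemma geo_lim u K p : 0 <= p <= 2^-1 -> (forall m, cabs (u m) <= K * p ^+ m) ->
  exists L, forall N, cabs (\sum_(m < N) u m - L) <= 4 * K * p ^+ N.
Proof.
move=> p01 uK.
have [x hx] := real_geo_lim p01 (fun m => le_trans (normRe_le (u m)) (uK m)).
have [y hy] := real_geo_lim p01 (fun m => le_trans (normIm_le (u m)) (uK m)).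
exists (x +i* y) => N; apply: le_trans (cabs_le_ReIm _) _.
have ReS : complex.Re (\sum_(m < N) u m) = \sum_(m < N) complex.Re (u m).
  by elim/big_rec2: _ => //= m a z _ <-; case: (u m) z => ? ? [].
have ImS : complex.Im (\sum_(m < N) u m) = \sum_(m < N) complex.Im (u m).
  by elim/big_rec2: _ => //= m a z _ <-; case: (u m) z => ? ? [].
have := lerD (hx N) (hy N); rewrite -ReS -ImS.
by case: (\sum_(m < N) u m) => a c /=; lra.
Qed.

Definition cauchy_prod u v (m : nat) : R[i] := \sum_(i < m.+1) u i * v (m - i)%N.

Lemma sum_cauchy_prod u v N :
  (\sum_(i < N) u i) * (\sum_(j < N) v j) =
  \sum_(m < N) cauchy_prod u v m + \sum_(i < N) \sum_(j < N | (N <= i + j)%N) u i * v j.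
Proof.
have -> : \sum_(m < N) cauchy_prod u v m = \sum_(i < N) \sum_(j < N | (i + j < N)%N) u i * v j.
  transitivity (\sum_(m < N) \sum_(i < N | (i <= m)%N) u i * v (m - i)%N).
    apply: eq_bigr => m _; rewrite /cauchy_prod.
    by rewrite (big_ord_widen N (fun i => u i * v (m - i)%N)).
  rewrite (exchange_big_dep predT)//=; apply: eq_bigr => i _.
  transitivity (\sum_(i <= m < N) u i * v (m - i)%N).
    by rewrite big_geq_mkord.
  rewrite -{1}[i : nat]add0n big_addn big_mkord.
  rewrite (big_ord_widen N (fun j => u i * v (j + i - i)%N)) ?leq_subr//.
  by apply: eq_big => [j|j _]; rewrite ?addnK// ltn_subRL.
rewrite mulr_suml -big_split /=; apply: eq_bigr => i _.
rewrite mulr_sumr (bigID (fun j : 'I_N => (i + j < N)%N)) /=; congr (_ + _).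
by apply: eq_bigl => j; rewrite -leqNgt.
Qed.

(** By [sum_cauchy_prod] only the corner [i + j >= N] has to be negligible: there [4^-(i+j)] is at
    most [2^-N 2^-i 2^-j], so the corner sums to at most [4 K K' 2^-N]. *)
Lemma cauchy_prod_lim u v K K' (Lu Lv Lw : R[i]) :
  (forall m, cabs (u m) <= K * 4^-1 ^+ m) -> (forall m, cabs (v m) <= K' * 4^-1 ^+ m) ->
  (forall N, cabs (\sum_(m < N) u m - Lu) <= 4 * K * 4^-1 ^+ N) ->
  (forall N, cabs (\sum_(m < N) v m - Lv) <= 4 * K' * 4^-1 ^+ N) ->
  (exists K'', forall N, cabs (\sum_(m < N) cauchy_prod u v m - Lw) <= K'' * 4^-1 ^+ N) ->
  Lw = Lu * Lv.
Proof.
move=> uK vK hu hv [K'' hw].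
have K0 : 0 <= K by have := uK 0; rewrite expr0 mulr1; apply: le_trans; exact: cabs_ge0.
have K'0 : 0 <= K' by have := vK 0; rewrite expr0 mulr1; apply: le_trans; exact: cabs_ge0.
have q12 N : 4^-1 ^+ N <= 2^-1 ^+ N :> R by rewrite lerXn2r ?nnegrE// lef_pV2 ?posrE// ler_nat.
have rest N : cabs (\sum_(i < N) \sum_(j < N | (N <= i + j)%N) u i * v j)
    <= 4 * K * K' * 2^-1 ^+ N.
  apply: le_trans (_ : \sum_(i < N) \sum_(j < N)
      (K * K' * 2^-1 ^+ N) * (2^-1 ^+ i * 2^-1 ^+ j) <= _).
    apply: le_trans (cabs_sum _ _ _) _; apply: ler_sum => i _.
    apply: le_trans (cabs_sum _ _ _) _; rewrite big_mkcond; apply: ler_sum => j _.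
    case: ifP => [Nij|_]; last by rewrite !mulr_ge0 ?exprn_ge0.
    rewrite cabsM; apply: le_trans (ler_pM (cabs_ge0 _) (cabs_ge0 _) (uK i) (vK j)) _.
    rewrite mulrACA -exprD -!mulrA ler_wpM2l// ler_wpM2l// -exprD.
    have -> : 4^-1 = 2^-1 * 2^-1 :> R by field.
    rewrite exprMn ler_wpM2r ?exprn_ge0//.
    by rewrite ler_wiXn2l// invf_le1// ler1n.
  under eq_bigr => i _ do rewrite -mulr_sumr -mulr_sumr.
  rewrite -mulr_sumr -mulr_suml.
  have := sum_half_le2 N.
  have : 0 <= \sum_(i < N) 2^-1 ^+ i :> R by apply: sumr_ge0 => i _; rewrite exprn_ge0.
  move: (\sum_(i < N) _) => s s0 s2.
  have : 0 <= K * K' * 2^-1 ^+ N by rewrite !mulr_ge0 ?exprn_ge0.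
  have : s * s <= 2 * 2 by apply: ler_pM.
  have -> : 4 * K * K' * 2^-1 ^+ N = K * K' * 2^-1 ^+ N * (2 * 2) by ring.
  by move=> ss x0; exact: ler_wpM2l.
apply/eqP; rewrite -subr_eq0; apply/eqP.
apply: (@cabs_le_half_eq0 _ (K'' + 4 * K * K' + 4 * K * (cabs Lv + 4 * K') + cabs Lu * (4 * K'))) => N.
set h := 2^-1 ^+ N.
set U := \sum_(m < N) u m; set V := \sum_(m < N) v m; set W := \sum_(m < N) cauchy_prod u v m.
have eU : cabs (U - Lu) <= 4 * K * h.
  by apply: le_trans (hu N) _; rewrite ler_wpM2l ?mulr_ge0.
have eV : cabs (V - Lv) <= 4 * K' * h.
  by apply: le_trans (hv N) _; rewrite ler_wpM2l ?mulr_ge0.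
have h1 : h <= 1 by rewrite exprn_ile1// invf_le1// ler1n.
have K''0 : 0 <= K'' by have := hw 0; rewrite expr0 mulr1; apply: le_trans; exact: cabs_ge0.
have eW : cabs (W - Lw) <= K'' * h.
  by apply: le_trans (hw N) _; rewrite ler_wpM2l.
have bV : cabs V <= cabs Lv + 4 * K'.
  rewrite -(subrK Lv V) addrC; apply: le_trans (cabsD _ _) _; rewrite lerD2l.
  by apply: le_trans eV _; rewrite ler_piMr ?mulr_ge0.
have eR : cabs (U * V - W) <= 4 * K * K' * h.
  by rewrite /U /V sum_cauchy_prod addrAC subrr add0r; exact: rest.
have -> : Lw - Lu * Lv = - (W - Lw) - (U * V - W) + (U - Lu) * V + Lu * (V - Lv) by ring.
apply: le_trans (cabsD _ _) _; rewrite [leRHS]mulrDl; apply: lerD; last first.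
  by rewrite cabsM -mulrA ler_wpM2l ?cabs_ge0.
apply: le_trans (cabsD _ _) _; rewrite [leRHS]mulrDl; apply: lerD; last first.
  rewrite cabsM mulrAC ler_pM ?cabs_ge0//.
apply: le_trans (cabsB _ _) _; rewrite [leRHS]mulrDl; apply: lerD => //.
by rewrite cabsN.
Qed.

End GeometricSeries.

Lemma mx_bounded (R : realType) (m n : nat) (M : 'M[R]_(m, n)) :
  exists b : nat, forall i j, `|M i j| <= b%:R.
Proof.
exists (Num.bound (\sum_i \sum_j `|M i j|)) => i j; rewrite ltW//.
apply: le_lt_trans (archi_boundP _); last by apply: sumr_ge0 => l _; exact: sumr_ge0.
rewrite (bigD1 i)//= (bigD1 j)//= -addrA lerDl addr_ge0// ?sumr_ge0// => l _.
exact: sumr_ge0.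
Qed.

(** * The sum S(a) and its functional equations *)

Section SumOfSeries.
Variables (R : realType) (n : nat) (B : 'M[R]_n) (r : 'I_n -> R[i]) (b : nat) (rho : R).
Implicit Types (a v : 'cV[R]_n) (i : 'I_n).
Hypothesis n0 : (0 < n)%N.
Hypothesis Bb : forall i j, `|B i j| <= b%:R.
Hypothesis rrho : forall i, cabs (r i) <= rho.
(** The ratio of [hpart_bound]; the bound by 1/4 is the one [cauchy_prod_lim] asks for. *)
Let p := (2 ^ n)%:R * lco_rate n b rho.
Hypothesis p4 : p <= 4^-1.

Let Q0 : 0 <= lco_rate n b rho.
Proof. by rewrite mulr_ge0// (le_trans _ (rrho (Ordinal n0))) ?cabs_ge0. Qed.

Let p0 : 0 <= p.
Proof. by rewrite mulr_ge0. Qed.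

Let p2 : p <= 2^-1.
Proof. by apply: le_trans p4 _; rewrite lef_pV2 ?posrE// ler_nat. Qed.

Let vec_bounded a : exists A : nat, forall i, `|a i 0| <= A%:R.
Proof. by have [A aA] := mx_bounded a; exists A. Qed.

Lemma geo_unique (s : nat -> R[i]) (L L' : R[i]) K K' :
  (forall N, cabs (s N - L) <= K * p ^+ N) -> (forall N, cabs (s N - L') <= K' * p ^+ N) -> L = L'.
Proof.
move=> h h'; apply/eqP; rewrite -subr_eq0; apply/eqP.
apply: (@cabs_le_half_eq0 _ _ (K + K')) => N.
have -> : L - L' = (s N - L') - (s N - L) by ring.
apply: le_trans (cabsB _ _) _.
have K0 : 0 <= K by have := h 0; rewrite expr0 mulr1; apply: le_trans; exact: cabs_ge0.
have K'0 : 0 <= K' by have := h' 0; rewrite expr0 mulr1; apply: le_trans; exact: cabs_ge0.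
have pN : p ^+ N <= 2^-1 ^+ N by rewrite lerXn2r ?nnegrE.
rewrite mulrDl addrC lerD//.
  by apply: le_trans (h N) _; rewrite ler_wpM2l.
by apply: le_trans (h' N) _; rewrite ler_wpM2l.
Qed.

(** Each bound [A] on [a] yields a limit; uniqueness of limits lets one value serve all of them, and
    choice makes it a function of [a]. *)
Lemma lsum_exists : exists S : 'cV[R]_n -> R[i], forall a A, (forall i, `|a i 0| <= A%:R) ->
  forall N, cabs (\sum_(m < N) hpart B r m a - S a) <= 4 * lco_cst R n b A * p ^+ N.
Proof.
have ex a : exists L : R[i], forall A : nat, (forall i, `|a i 0| <= A%:R) ->
  forall N, cabs (\sum_(m < N) hpart B r m a - L) <= 4 * lco_cst R n b A * p ^+ N.
  have lim A : (forall i, `|a i 0| <= A%:R) -> exists L : R[i],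
      forall N, cabs (\sum_(m < N) hpart B r m a - L) <= 4 * lco_cst R n b A * p ^+ N.
    move=> aA; apply: (@geo_lim _ (hpart B r ^~ a) (lco_cst R n b A) p); first by rewrite p0.
    by move=> m; exact: hpart_bound.
  have [A0 aA0] := vec_bounded a; have [L hL] := lim A0 aA0.
  exists L => A aA; have [L' hL'] := lim A aA.
  by rewrite (geo_unique hL hL').
by exists (fun a => projT1 (cid (ex a))) => a; exact: projT2 (cid (ex a)).
Qed.

Variable S : 'cV[R]_n -> R[i].
Hypothesis hS : forall a A, (forall i, `|a i 0| <= A%:R) ->
  forall N, cabs (\sum_(m < N) hpart B r m a - S a) <= 4 * lco_cst R n b A * p ^+ N.

Lemma lsum_close1 a (A : nat) : (forall i, `|a i 0| <= A%:R) ->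
  cabs (S a - 1) <= 4 * lco_cst R n b A * p.
Proof.
by move=> /hS /(_ 1%N); rewrite big_ord1 hpart0 cabs_distC expr1.
Qed.

Lemma lsum0 : S 0 = 1.
Proof.
have [A hA] := vec_bounded 0; apply: esym.
(* Indexing by [N.+1] skips the empty sum; all later partial sums at [0] are exactly 1. *)
apply: (@geo_unique (fun N => \sum_(m < N.+1) hpart B r m 0) _ _ 0 (4 * lco_cst R n b A * p)) => N.
  rewrite big_ord_recl hpart0 big1 => [|i _]; last by rewrite lift0 hpartS_0.
  by rewrite addr0 subrr cabs0 mul0r.
by rewrite -mulrA -exprS; exact: hS.
Qed.

(** By [hpartD] the Cauchy product of the series at [a] and at [v] is the series at [a + v]. *)
Lemma lsumD a v : S (a + v) = S a * S v.
Proof.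
have pq N : p ^+ N <= 4^-1 ^+ N by rewrite lerXn2r ?nnegrE.
have [A hA] := vec_bounded a; have [A' hA'] := vec_bounded v.
have [A'' hA''] := vec_bounded (a + v).
have K0 C : 0 <= lco_cst R n b C by [].
apply: (@cauchy_prod_lim _ (hpart B r ^~ a) (hpart B r ^~ v) (lco_cst R n b A) (lco_cst R n b A')).
- by move=> m; apply: le_trans (hpart_bound Bb rrho m n0 hA) _; rewrite ler_wpM2l.
- by move=> m; apply: le_trans (hpart_bound Bb rrho m n0 hA') _; rewrite ler_wpM2l.
- by move=> m; apply: le_trans (hS hA m) _; rewrite ler_wpM2l ?mulr_ge0.
- by move=> m; apply: le_trans (hS hA' m) _; rewrite ler_wpM2l ?mulr_ge0.
- exists (4 * lco_cst R n b A'') => N.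
  have cE m : cauchy_prod (hpart B r ^~ a) (hpart B r ^~ v) m = hpart B r m (a + v) by exact: hpartD.
  rewrite (eq_bigr _ (fun (m : 'I_N) _ => cE m)).
  by apply: le_trans (hS hA'' N) _; rewrite ler_wpM2l ?mulr_ge0.
Qed.

Lemma lsum_incr a i : S (a + delta_mx i 0) = S a - r i * S (a + col i B).
Proof.
have [A hA] := vec_bounded a; have [A' hA'] := vec_bounded (a + delta_mx i 0).
have [A'' hA''] := vec_bounded (a + col i B).
(* The recursion lowers the degree by one, so [N.+1] terms at [a] are matched with [N] terms at
   [a + col i B]. *)
apply: (@geo_unique (fun N => \sum_(m < N.+1) hpart B r m (a + delta_mx i 0)) _ _
  (4 * lco_cst R n b A' * p) (4 * lco_cst R n b A * p + cabs (r i) * (4 * lco_cst R n b A''))) => N.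
  by rewrite -mulrA -exprS; exact: hS.
rewrite big_ord_recl hpart0.
under eq_bigr => m _ do rewrite lift0 hpart_incr.
rewrite sumrB -mulr_sumr addrA.
have -> : 1 + \sum_(m < N) hpart B r m.+1 a = \sum_(m < N.+1) hpart B r m a.
  by rewrite big_ord_recl hpart0; under [in RHS]eq_bigr => m _ do rewrite lift0.
set X := \sum_(m < N.+1) _; set Y := \sum_(m < N) _.
have -> : X - r i * Y - (S a - r i * S (a + col i B)) =
  (X - S a) - r i * (Y - S (a + col i B)) by ring.
apply: le_trans (cabsB _ _) _; rewrite [leRHS]mulrDl; apply: lerD.
  by rewrite -mulrA -exprS; exact: hS.
by rewrite cabsM -mulrA ler_wpM2l ?cabs_ge0//; exact: hS.
Qed.

(** The sum factors over the coordinates into [n] geometric sums, each at most 2. *)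
Lemma sum_pow_box (q : R) N : 0 <= q <= 2^-1 ->
  \sum_(k : {ffun 'I_n -> 'I_N}) q ^+ (\sum_j k j) <= 2 ^+ n.
Proof.
move=> /andP[q0 q2].
under eq_bigr => k _ do rewrite expr_sum.
rewrite -(bigA_distr_bigA (fun (_ : 'I_n) (j : 'I_N) => q ^+ j)) /=.
rewrite prodr_const card_ord lerXn2r ?nnegrE ?sumr_ge0// => [i _|]; first exact: exprn_ge0.
apply: le_trans (sum_half_le2 R N); apply: ler_sum => j _.
by rewrite lerXn2r ?nnegrE.
Qed.

Let lQp : lco_rate n b rho <= p.
Proof. by rewrite /p ler_peMl// ler1n expn_gt0. Qed.

Lemma abs_box a (A : nat) N : (forall i, `|a i 0| <= A%:R) ->
  \sum_(k : {ffun 'I_n -> 'I_N}) cabs (lterm B r a (fun j => k j)) <= lco_cst R n b A * 2 ^+ n.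
Proof.
move=> aA.
apply: le_trans (_ : \sum_(k : {ffun 'I_n -> 'I_N}) lco_cst R n b A * lco_rate n b rho ^+ (\sum_j k j) <= _).
  by apply: ler_sum => k _; exact: (lterm_bound Bb rrho (fun j => k j) aA).
by rewrite -mulr_sumr ler_wpM2l// sum_pow_box// Q0 (le_trans lQp).
Qed.

(** A box of side [N.+1] contains all terms of degree at most [N]; its other terms have degree above
    [N] and form a small tail. *)
Lemma box_lim a e : 0 < e -> exists N0, forall N, (N0 <= N)%N ->
  cabs (\sum_(k : {ffun 'I_n -> 'I_N}) lterm B r a (fun j => k j) - S a) < e.
Proof.
move=> e0; have [A aA] := vec_bounded a; set K := lco_cst R n b A.
have K0 : 0 <= K by [].
have e20 : 0 < e / 2 by rewrite divr_gt0.
have [N0 hN0] := expr_half_small (4 * K + K * 2 ^+ n) e20.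
exists N0.+1 => -[//|N] NN.
apply: (@le_lt_trans _ _ (e / 2)); last by rewrite ltr_pdivrMr// mulr_natr mulr2n ltrDl.
apply: le_trans (hN0 N.+1 _); last exact: ltnW.
have -> : \sum_(k : {ffun 'I_n -> 'I_N.+1}) lterm B r a (fun j => k j) =
   \sum_(m < N.+1) hpart B r m a +
   \sum_(k : {ffun 'I_n -> 'I_N.+1} | (N < \sum_j k j)%N) lterm B r a (fun j => k j).
  rewrite (bigID (fun k : {ffun 'I_n -> 'I_N.+1} => (N < \sum_j k j)%N)) /= addrC.
  congr (_ + _).
  have hE (m : 'I_N.+1) : true -> hpart B r m a =
     \sum_(k : {ffun 'I_n -> 'I_N.+1} | (\sum_j k j)%N == m) lterm B r a (fun j => k j).
    by move=> _; apply: hpartE; rewrite -ltnS.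
  rewrite (eq_bigr _ hE).
  under [in RHS]eq_bigr => m _ do rewrite big_mkcond.
  rewrite exchange_big /= big_mkcond /=; apply: eq_bigr => k _.
  rewrite -leqNgt; case: leqP => kN.
    rewrite (bigD1 (Ordinal (kN : (_ < N.+1)%N)))//= eqxx big1 ?addr0// => m mk.
    by rewrite ifF//; apply/negbTE; rewrite eq_sym -val_eqE in mk *.
  by rewrite big1// => m _; rewrite ifF// gtn_eqF// (leq_trans (ltn_ord m)).
rewrite addrAC; apply: le_trans (cabsD _ _) _; rewrite mulrDl; apply: lerD.
  apply: le_trans (hS aA N.+1) _; rewrite ler_wpM2l ?mulr_ge0//.
  by rewrite lerXn2r ?nnegrE.
apply: le_trans (cabs_sum _ _ _) _.
apply: le_trans (_ : \sum_(k : {ffun 'I_n -> 'I_N.+1})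
    K * 2^-1 ^+ N.+1 * 2^-1 ^+ (\sum_j k j) <= _).
  rewrite big_mkcond; apply: ler_sum => k _; case: ifP => [kN|_]; last first.
    by rewrite !mulr_ge0 ?exprn_ge0.
  apply: le_trans (lterm_bound Bb rrho (fun j => k j) aA) _.
  rewrite -mulrA ler_wpM2l//.
  (* The ratio 1/4 is split in two: one factor 1/2 gives the decay in [N], the other is summed over
     the box. *)
  apply: le_trans (_ : (2^-1 * 2^-1) ^+ (\sum_j k j) <= _).
    have q0 : 0 <= 2^-1 * 2^-1 :> R by rewrite mulr_ge0.
    rewrite lerXn2r ?nnegrE//; apply: le_trans lQp _; apply: le_trans p4 _.
    by lra.
  by rewrite exprMn ler_wpM2r ?exprn_ge0// ler_wiXn2l// invf_le1// ler1n.
rewrite -mulr_sumr mulrAC ler_wpM2r ?exprn_ge0// ler_wpM2l//.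
by apply: sum_pow_box; rewrite lexx andbT.
Qed.

End SumOfSeries.

(** * Principal powers and one-parameter characters *)

Section PrincipalPower.
Variable R : realType.
Implicit Types (z : R[i]) (s t x : R).

Lemma cpowD z s t : z != 0 -> cpow z (s + t) = cpow z s * cpow z t.
Proof.
move=> z0; rewrite /cpow (negbTE z0).
have m0 : cabs z != 0 by apply: contraNneq z0 => /cabs_eq0 ->.
rewrite powRD ?m0 ?implybT// rmorphM mulrACA; congr (_ * _).
rewrite !mulrDl cosD sinD.
by apply/eqP; rewrite eq_complex /=; apply/andP; split; apply/eqP; ring.
Qed.

Lemma cos_sin_carg z : 0 < complex.Re z ->
  cos (carg z) = complex.Re z / cabs z /\ sin (carg z) = complex.Im z / cabs z.
Proof.
case: z => x y /= x0; rewrite /carg /cabs /= x0.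
have c0 : cos (atan (y / x)) = x / Num.sqrt (x ^+ 2 + y ^+ 2).
  rewrite cos_atan (_ : 1 + (y / x) ^+ 2 = (x ^+ 2 + y ^+ 2) / x ^+ 2); last first.
    by field; rewrite gt_eqF.
  rewrite sqrtrM ?addr_ge0 ?sqr_ge0// sqrtrV ?sqr_ge0// sqrtr_sqr gtr0_norm//.
  by rewrite invfM invrK mulrC.
split=> //; have := atanK (y / x); rewrite /tan => tE.
have s0 : 0 < Num.sqrt (x ^+ 2 + y ^+ 2) by rewrite sqrtr_gt0 ltr_wpDr ?sqr_ge0// exprn_gt0.
have cn0 : cos (atan (y / x)) != 0 by rewrite c0 mulf_neq0 ?invr_eq0 ?gt_eqF.
rewrite -[LHS](divfK cn0) tE c0; field.
by rewrite !gt_eqF.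
Qed.

Lemma cpow1 z : 0 < complex.Re z -> cpow z 1 = z.
Proof.
move=> z0; have zn0 : z != 0 by apply: contraTneq z0 => ->; rewrite ltxx.
rewrite /cpow (negbTE zn0) mul1r powRr1 ?cabs_ge0//.
have [-> ->] := cos_sin_carg z0.
have m0 : cabs z != 0 by apply: contraNneq zn0 => /cabs_eq0 ->.
by apply/eqP; rewrite eq_complex /=; apply/andP; split; apply/eqP; field.
Qed.

(** The modulus of the power lies between 1 and [cabs z], and the angle [t * carg z] is no larger in
    size than [carg z], so its cosine is no smaller. *)
Lemma cpow_near1 z t : cabs (z - 1) <= 400^-1 -> 0 <= t <= 1 -> cabs (cpow z t - 1) <= 8^-1.
Proof.
move=> z1 /andP[t0 t1].
have zE : complex.Re z - 1 = complex.Re (z - 1) by case: (z).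
have x1 : `|complex.Re z - 1| <= 400^-1 by rewrite zE (le_trans (normRe_le _)).
have x0 : 0 < complex.Re z by move: x1; rewrite ler_norml => /andP[]; lra.
have zn0 : z != 0 by apply: contraTneq x0 => ->; rewrite ltxx.
have m1 : 1 - 400^-1 <= cabs z <= 1 + 400^-1.
  apply/andP; split.
    have := cabsB z (z - 1); rewrite opprB addrC subrK cabs1; move: z1; lra.
  have := cabsD (z - 1) 1; rewrite subrK cabs1; move: z1; lra.
have m0 : 0 < cabs z by lra.
have pt : `|cabs z `^ t - 1| <= 400^-1.
  have [h|h] := leP 1 (cabs z).
    have := ler_powR h t0; have := ler_powR h t1.
    rewrite powRr0 powRr1 ?cabs_ge0// => h1 h2; rewrite ler_norml; apply/andP; split; lra.
  have h' : 0 < cabs z <= 1 by lra.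
  have := ger_powR h' t0; have := ger_powR h' t1.
  rewrite powRr0 powRr1 ?cabs_ge0// => h1 h2; rewrite ler_norml; apply/andP; split; lra.
have [cE _] := cos_sin_carg x0.
have ct : 1 - 2 * 400^-1 <= cos (t * carg z).
  apply: le_trans (_ : cos (carg z) <= _).
    rewrite cE ler_pdivlMr//; move: x1; rewrite ler_norml => /andP[x1 _].
    have : (1 - 2 * 400^-1) * cabs z <= (1 - 2 * 400^-1) * (1 + 400^-1) by rewrite ler_wpM2l; lra.
    by lra.
  rewrite -(cos_norm (carg z)) -(cos_norm (t * carg z)) normrM (ger0_norm t0).
  have cpi : `|carg z| <= pi.
    rewrite /carg x0 ler_norml.
    have := atan_gtNpi2 (complex.Im z / complex.Re z).
    have := atan_ltpi2 (complex.Im z / complex.Re z).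
    have := pi_gt0 R; move: pi => q; move=> q0 h1 h2; apply/andP; split; lra.
  have tc : t * `|carg z| <= `|carg z| by rewrite ler_piMl.
  rewrite le_eqVlt; have [->|ne] := eqVneq (t * `|carg z|) `|carg z|.
    by rewrite eqxx.
  rewrite ltr_cos ?in_itv /= ?normr_ge0 ?cpi ?mulr_ge0 ?(le_trans tc)//.
  by rewrite lt_neqAle ne tc orbT.
(* The cosine bound gives sin^2 <= 1 - (1 - 2/400)^2 <= 4/400 = (1/10)^2. *)
have st : `|sin (t * carg z)| <= 10^-1.
  rewrite -[leRHS]ger0_norm// -ler_sqr ?nnegrE// !real_normK ?num_real// sin2cos2.
  have := ler_pM _ _ ct ct; have := cos_le1 (t * carg z); nra.
rewrite /cpow (negbTE zn0); apply: le_trans (cabs_le_ReIm _) _.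
rewrite /= !mul0r subr0 addr0 oppr0 addr0.
set P := cabs z `^ t in pt *; set c := cos _ in ct *; set s := sin _ in st *.
have c1 : c <= 1 by exact: cos_le1.
move: pt; rewrite ler_norml => /andP[p1 p2].
have h1 : `|P * c - 1| <= 3 * 400^-1.
  rewrite ler_norml; apply/andP; split; nra.
have h2 : `|P * s| <= (1 + 400^-1) * 10^-1.
  rewrite normrM ler_pM// ger0_norm; lra.
by apply: le_trans (lerD h1 h2) _; lra.
Qed.

(** Periodicity spreads the bound to all [t >= 0]. Since [g (t + t) - 1 = (g t + 1) * (g t - 1)] and
    [|g t + 1| >= 3/2], doubling expands the distance to 1, so a bounded distance must be 0. *)
Lemma one_param_trivial (g : R -> R[i]) :
  (forall s t, g (s + t) = g s * g t) -> g 1 = 1 ->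
  (forall t, 0 <= t <= 1 -> cabs (g t - 1) <= 2^-1) ->
  forall t, 0 <= t -> g t = 1.
Proof.
move=> gD g1 gb.
have gnat (m : nat) t : g (t + m%:R) = g t.
  elim: m => [|m IH]; first by rewrite addr0.
  by rewrite -natr1 addrA gD g1 mulr1.
have gb' t : 0 <= t -> cabs (g t - 1) <= 2^-1.
  move=> t0; rewrite -[t](subrK (Num.truncn t)%:R) gnat; apply: gb.
  by have /andP[] := truncn_itv t0; rewrite -natr1; lra.
have dbl t : 0 <= t -> 3 / 2 * cabs (g t - 1) <= cabs (g (t + t) - 1).
  move=> t0; rewrite gD (_ : _ * _ - 1 = (g t + 1) * (g t - 1)); last by ring.
  rewrite cabsM ler_wpM2r ?cabs_ge0//.
  have := cabsB (g t + 1) (g t - 1); rewrite (_ : _ - _ = 2%:R); last by ring.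
  by rewrite cabs_nat; move: (gb' t t0); lra.
(* Two doublings expand by 9/4, which is at least 2; hence a factor 1/2 per step. *)
have small m : forall t, 0 <= t -> cabs (g t - 1) <= 2^-1 * 2^-1 ^+ m.
  elim: m => [|m IH] t t0; first by rewrite mulr1 gb'.
  have t20 : 0 <= t + t by rewrite addr_ge0.
  have := dbl _ t0; have := dbl _ t20; have := IH _ (addr_ge0 t20 t20).
  rewrite exprS; have : 0 <= 2^-1 ^+ m :> R by rewrite exprn_ge0.
  move: (2^-1 ^+ m) (cabs_ge0 (g t - 1)) => q; lra.
move=> t t0; apply/eqP; rewrite -subr_eq0; apply/eqP.
by apply: (@cabs_le_half_eq0 _ _ 2^-1) => m; exact: small.
Qed.

Lemma one_param_cpow (n : nat) (S : 'cV[R]_n -> R[i]) (v : 'cV[R]_n) :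
  S 0 = 1 -> (forall a b, S (a + b) = S a * S b) ->
  (forall t, `|t| <= 1 -> cabs (S (t *: v) - 1) <= 400^-1) ->
  forall t, 0 <= t -> cpow (S v) t = S (t *: v).
Proof.
move=> S0 SD Sb t t0.
have Sv : cabs (S v - 1) <= 400^-1 by have := Sb 1; rewrite scale1r normr1; exact.
have vE : complex.Re (S v) - 1 = complex.Re (S v - 1) by case: (S v).
have x1 : `|complex.Re (S v) - 1| <= 400^-1 by rewrite vE (le_trans (normRe_le _)).
have x0 : 0 < complex.Re (S v) by move: x1; rewrite ler_norml => /andP[]; lra.
have zn0 : S v != 0 by apply: contraTneq x0 => ->; rewrite ltxx.
have SN a : S (- a) * S a = 1 by rewrite -SD addNr.
(* The quotient of the principal power by the character; it is 1 at [s = 1] by [cpow1]. *)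
pose g s := S (- (s *: v)) * cpow (S v) s.
suff gt : g t = 1.
  by rewrite -[LHS]mul1r -(SN (t *: v)) mulrAC [_ * cpow _ _]gt mul1r.
apply: (one_param_trivial (g := g)) => //.
- by move=> s u; rewrite /g scalerDl opprD SD cpowD// mulrACA.
- by rewrite /g scale1r cpow1.
- move=> s /andP[s0 s1].
  have h1 : cabs (S (- (s *: v)) - 1) <= 400^-1.
    by rewrite -scaleNr; apply: Sb; rewrite normrN ger0_norm.
  have h2 : cabs (cpow (S v) s - 1) <= 8^-1 by apply: cpow_near1 => //; rewrite s0.
  rewrite /g; set a := S _ in h1 *; set c := cpow _ _ in h2 *.
  have -> : a * c - 1 = (a - 1) * (c - 1) + (a - 1) + (c - 1) by ring.
  apply: le_trans (cabsD _ _) _.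
  have := cabsD ((a - 1) * (c - 1)) (a - 1); rewrite cabsM.
  have := ler_pM (cabs_ge0 _) (cabs_ge0 _) h1 h2.
  by lra.
Qed.

End PrincipalPower.

(** * Local uniqueness of solutions of the trinomial system *)

Section LocalUniqueness.
Variables (R : realType) (n : nat).
Implicit Types (y Y : 'I_n -> R[i]) (alpha : 'I_n -> nat).

Definition near1 (eta : R) y := forall j, cabs (y j - 1) <= eta.

(** Quantitative differentiability at (1, .., 1), with value 1 and gradient [l]; [D] is a vector of
    divided differences. *)
Definition approx_linear (f : ('I_n -> R[i]) -> R[i]) (l : 'I_n -> nat) :=
  exists2 C : R, 0 <= C & forall eta y Y, 0 <= eta <= 1 -> near1 eta y -> near1 eta Y ->
    cabs (f y - 1) <= C * eta /\
    exists2 D : 'I_n -> R[i], f y - f Y = \sum_j D j * (y j - Y j) &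
      forall j, cabs (D j - (l j)%:R) <= C * eta.

Lemma approx_linear1 : approx_linear (fun _ => 1) (fun _ => 0%N).
Proof.
exists 0 => // eta y Y _ _ _; split; first by rewrite subrr cabs0 mul0r.
exists (fun _ => 0) => [|j]; last by rewrite subrr cabs0 mul0r.
by rewrite subrr big1// => j _; rewrite mul0r.
Qed.

Lemma approx_linear_coord i : approx_linear (fun y => y i) (fun j => (j == i) : nat).
Proof.
exists 1 => // eta y Y /andP[e0 _] hy hY; split; first by rewrite mul1r.
exists (fun j => (j == i)%:R) => [|j]; last by rewrite subrr cabs0 mul1r.
rewrite (bigD1 i)//= eqxx mul1r big1 ?addr0// => j /negbTE ->.
by rewrite mul0r.
Qed.

Lemma approx_linearM f g l l' : approx_linear f l -> approx_linear g l' ->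
  approx_linear (fun y => f y * g y) (fun j => (l j + l' j)%N).
Proof.
move=> [C C0 hf] [C' C'0 hg].
pose L : R := (\sum_j l j)%:R; pose L' : R := (\sum_j l' j)%:R.
have lL j : (l j)%:R <= L by rewrite ler_nat le_sum_coord.
have lL' j : (l' j)%:R <= L' by rewrite ler_nat le_sum_coord.
have [L0 L'0] : 0 <= L /\ 0 <= L' by [].
(* The summands bound the errors from [D - l], [g y - 1], [f Y - 1] and [D' - l'] in the product
   rule. *)
exists (C * (1 + C') + L * C' + C * (L' + C') + C').
  by rewrite !addr_ge0 ?mulr_ge0 ?addr_ge0.
move=> eta y Y /[dup] e01 /andP[e0 e1] hy hY.
have [f1 [D fD Dl]] := hf eta y Y e01 hy hY.
have [g1 [D' gD D'l]] := hg eta y Y e01 hy hY.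
have [fY _] := hf eta Y Y e01 hY hY.
have gy : cabs (g y) <= 1 + C'.
  rewrite -[g y](subrK 1) addrC; apply: le_trans (cabsD _ _) _.
  by rewrite cabs1 lerD2l (le_trans g1)// ler_piMr.
have h1 : 0 <= C * eta by rewrite mulr_ge0.
have h2 : 0 <= C' * eta by rewrite mulr_ge0.
have h3 : 0 <= L * (C' * eta) by rewrite mulr_ge0.
have h4 : 0 <= (L' + C') * (C * eta) by rewrite mulr_ge0 ?addr_ge0.
split.
  have -> : f y * g y - 1 = (f y - 1) * g y + (g y - 1) by ring.
  apply: le_trans (cabsD _ _) _; rewrite cabsM.
  have := ler_pM (cabs_ge0 _) (cabs_ge0 _) f1 gy; lra.
exists (fun j => D j * g y + f Y * D' j) => [|j].
  have -> : f y * g y - f Y * g Y = (f y - f Y) * g y + f Y * (g y - g Y) by ring.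
  rewrite fD gD mulr_suml mulr_sumr -big_split; apply: eq_bigr => j _ /=; ring.
have -> : D j * g y + f Y * D' j - (l j + l' j)%:R =
   (D j - (l j)%:R) * g y + (l j)%:R * (g y - 1) + ((f Y - 1) * D' j + (D' j - (l' j)%:R)).
  by rewrite natrD; ring.
have dD' : cabs (D' j) <= L' + C'.
  rewrite -[D' j](subrK (l' j)%:R) addrC; apply: le_trans (cabsD _ _) _.
  by rewrite cabs_nat lerD// (le_trans (D'l j))// ler_piMr.
have b1 := ler_pM (cabs_ge0 _) (cabs_ge0 _) (Dl j) gy.
have b2 := ler_pM (ler0n R (l j)) (cabs_ge0 _) (lL j) g1.
have b3 := ler_pM (cabs_ge0 _) (cabs_ge0 _) fY dD'.
have b4 := D'l j.
apply: le_trans (cabsD _ _) _; apply: le_trans (lerD (cabsD _ _) (cabsD _ _)) _.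
rewrite !cabsM cabs_nat; lra.
Qed.

Lemma approx_linear_monom alpha : approx_linear (fun y => monom y alpha) alpha.
Proof.
suff H (s : seq 'I_n) : approx_linear (fun y => \prod_(i <- s) y i ^+ alpha i)
    (fun j => (\sum_(i <- s) (j == i) * alpha i)%N).
  have := H (index_enum _); rewrite /monom.
  suff -> : (fun j => (\sum_i (j == i) * alpha i)%N) = alpha by [].
  apply/funext => j; rewrite (bigD1 j)//= eqxx mul1n big1 ?addn0// => i.
  by rewrite eq_sym => /negbTE ->.
have ext f g l l' : f = g -> l = l' -> approx_linear f l -> approx_linear g l'.
  by move=> -> ->.
elim: s => [|i s IH].
  by apply: ext approx_linear1; apply/funext => y; rewrite big_nil.
have Hi m : approx_linear (fun y => y i ^+ m) (fun j => ((j == i) * m)%N).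
  elim: m => [|m IHm].
    by apply: ext approx_linear1; apply/funext => j; rewrite ?muln0.
  apply: ext (approx_linearM (approx_linear_coord i) IHm); apply/funext => j.
    by rewrite exprS.
  by rewrite mulnS.
by apply: ext (approx_linearM (Hi (alpha i)) IH); apply/funext => j; rewrite big_cons.
Qed.

Variables mu nu beta : 'I_n -> 'I_n -> nat.

Definition trinomial_sol (r y : 'I_n -> R[i]) := forall i,
  r i * monom y (beta i) + monom y (mu i) - monom y (nu i) = 0.

(** Subtracting the two systems gives a linear system for [y - Y] whose matrix is within O(eta) of
    the transpose of [kappa]; inverting [kappa] bounds the distance by half of itself. *)
Lemma trinomial_unique : kappa R mu nu \in unitmx ->
  exists2 eta : R, 0 < eta & forall r y Y : 'I_n -> R[i],
    (forall i, cabs (r i) <= eta) -> near1 eta y -> near1 eta Y ->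
    trinomial_sol r y -> trinomial_sol r Y -> forall j, y j = Y j.
Proof.
move=> ku.
pose bounded_by alpha (C : R) := 0 <= C /\
   forall eta y Y, 0 <= eta <= 1 -> near1 eta y -> near1 eta Y ->
    exists2 D : 'I_n -> R[i], monom y alpha - monom Y alpha = \sum_j D j * (y j - Y j) &
      forall j, cabs (D j - (alpha j)%:R) <= C * eta.
have [C hC] : {C : _ -> R & forall alpha, bounded_by alpha (C alpha)}.
  apply: choice => alpha.
  have [C C0 h] := approx_linear_monom alpha; exists C; split=> // eta y Y e01 hy hY.
  by have [_] := h eta y Y e01 hy hY.
(* The first two summands bound the divided differences of the [beta] monomial, which come
   multiplied by the small [r i]; the others bound the deviations for [mu] and [nu]. *)
pose M0 i : R := (\sum_j beta i j)%:R + C (beta i) + C (mu i) + C (nu i).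
have M00 i : 0 <= M0 i by rewrite !addr_ge0//; [case: (hC (beta i))|case: (hC (mu i))|case: (hC (nu i))].
pose M := \sum_i M0 i.
have MM i : M0 i <= M by rewrite /M (bigD1 i)//= lerDl sumr_ge0.
have M_ge0 : 0 <= M by rewrite sumr_ge0.
pose W := \sum_l \sum_i `|invmx (kappa R mu nu) i l|.
have W0 : 0 <= W by apply: sumr_ge0 => l _; exact: sumr_ge0.
have WM0 : 0 <= W * M by rewrite mulr_ge0.
pose eta : R := (2 * (W * M + 1))^-1.
have eta0 : 0 < eta by rewrite invr_gt0 mulr_gt0// ltr_wpDl.
have eta1 : eta <= 1 by rewrite invf_le1 ?mulr_gt0// ?ltr_wpDl//; lra.
have etaW : W * M * eta <= 2^-1.
  rewrite /eta ler_pdivrMr ?mulr_gt0 ?ltr_wpDl//; lra.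
exists eta => // r y Y hr hy hY sy sY.
have e01 : 0 <= eta <= 1 by rewrite ltW.
pose h j := y j - Y j; pose H := \sum_j cabs (h j).
have H0 : 0 <= H by apply: sumr_ge0 => j _; exact: cabs_ge0.
have hH j : cabs (h j) <= H.
  by rewrite /H (bigD1 j)//= lerDl sumr_ge0// => i _; exact: cabs_ge0.
(* [g] is the linearization at [r = 0] applied to [h]; the two systems leave only error terms for
   it. *)
pose g i := \sum_j (kappa R mu nu j i)%:C * h j.
have gb i : cabs (g i) <= M * eta * H.
  have [Cb0 hb] := hC (beta i); have [Db Eb Lb] := hb eta y Y e01 hy hY.
  have [Cm0 hm] := hC (mu i); have [Dm Em Lm] := hm eta y Y e01 hy hY.
  have [Cn0 hn] := hC (nu i); have [Dn En Ln] := hn eta y Y e01 hy hY.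
  have gE : g i = - \sum_j (r i * Db j + (Dm j - (mu i j)%:R) - (Dn j - (nu i j)%:R)) * h j.
    have e0 : r i * (monom y (beta i) - monom Y (beta i)) +
       (monom y (mu i) - monom Y (mu i)) - (monom y (nu i) - monom Y (nu i)) = 0.
      have := sy i; have := sY i; move=> e1 e2.
      by rewrite -[RHS](subrr 0) -{1}e2 -e1; ring.
    apply/eqP; rewrite -subr_eq0 opprK; apply/eqP; rewrite -[RHS]e0 Eb Em En.
    rewrite /g mulr_sumr -!big_split -sumrB /=; apply: eq_bigr => j _.
    by rewrite !mxE rmorphB !rmorph_nat /h; ring.
  rewrite gE cabsN; apply: le_trans (cabs_sum _ _ _) _.
  rewrite /H mulr_sumr; apply: ler_sum => j _; rewrite cabsM ler_wpM2r ?cabs_ge0//.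
  apply: le_trans (_ : M0 i * eta <= _); last by rewrite ler_wpM2r// ltW.
  apply: le_trans (cabsB _ _) _; apply: le_trans (lerD (cabsD _ _) (lexx _)) _.
  rewrite /M0 !mulrDl; apply: lerD; last exact: Ln.
  apply: lerD; last exact: Lm.
  rewrite cabsM -mulrDl mulrC ler_pM ?cabs_ge0//.
  rewrite -[Db j](subrK (beta i j)%:R) addrC; apply: le_trans (cabsD _ _) _.
  rewrite cabs_nat lerD// ?ler_nat ?le_sum_coord//.
  by apply: le_trans (Lb j) _; rewrite ler_piMr.
have hE l : h l = \sum_i (invmx (kappa R mu nu) i l)%:C * g i.
  under eq_bigr => i _ do rewrite mulr_sumr.
  rewrite exchange_big /=.
  transitivity (\sum_j ((kappa R mu nu *m invmx (kappa R mu nu)) j l)%:C * h j).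
    rewrite mulmxV// (bigD1 l)//= mxE eqxx mul1r big1 ?addr0// => j /negbTE jl.
    by rewrite mxE jl mul0r.
  apply: eq_bigr => j _; rewrite [X in X%:C]mxE rmorph_sum mulr_suml.
  by apply: eq_bigr => i _; rewrite rmorphM /=; ring.
have HH : H <= W * (M * eta * H).
  rewrite /W mulr_suml; apply: ler_sum => l _; rewrite [X in cabs X]hE.
  apply: le_trans (cabs_sum _ _ _) _; rewrite mulr_suml; apply: ler_sum => i _.
  by rewrite cabsM cabs_real ler_wpM2l.
have H00 : H = 0.
  apply/eqP; rewrite eq_le H0 andbT.
  have : W * M * eta * H <= 2^-1 * H by rewrite ler_wpM2r.
  by move: HH; lra.
move=> j; apply/eqP; rewrite -subr_eq0; apply/eqP/cabs_eq0/eqP.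
by rewrite eq_le cabs_ge0 andbT -H00; exact: hH.
Qed.

End LocalUniqueness.

(** * Monomials as values of a character *)

Section Characters.
Variables (R : realType) (n : nat) (S : 'cV[R]_n -> R[i]).
Hypothesis S0 : S 0 = 1.
Hypothesis SD : forall a b, S (a + b) = S a * S b.

Lemma char_nat (v : 'cV[R]_n) (m : nat) : S (m%:R *: v) = S v ^+ m.
Proof.
elim: m => [|m IH]; first by rewrite scale0r S0.
by rewrite -natr1 scalerDl scale1r SD IH exprSr.
Qed.

Lemma char_prod (M : 'M[R]_n) (t : 'I_n -> R) :
  \prod_j S (t j *: (M *m delta_mx j 0)) = S (M *m \col_j t j).
Proof.
rewrite -(big_morph S SD S0); congr S.
under eq_bigr => j _ do rewrite scalemxAr.
rewrite -mulmx_sumr; congr (_ *m _); apply/colP => l.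
rewrite summxE (bigD1 l)//= !mxE !eqxx mulr1 big1 ?addr0// => j /negbTE jl.
by rewrite !mxE [l == j]eq_sym jl mulr0.
Qed.

Lemma char_monom (M : 'M[R]_n) (alpha : 'I_n -> nat) :
  monom (fun j => S (M *m delta_mx j 0)) alpha = S (M *m \col_j (alpha j)%:R).
Proof. by rewrite -char_prod /monom; apply: eq_bigr => j _; rewrite char_nat. Qed.

End Characters.

(** * Choice of the radius and identification of the series with the principal solution *)

Unset Implicit Arguments.

(* Exponent vectors: mu i, nu i, beta i : 'I_n -> nat are mu^(i), nu^(i), beta^(i).
   r : 'I_n -> R[i] is the coefficient vector (r_1, ..., r_n), y r the
   principal solution at r. *)
Theorem theorem1 (R : realType) (n : nat) (hn : (0 < n)%N)
  (mu nu beta : 'I_n -> 'I_n -> nat)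
  (hdist : forall i, mu i <> nu i /\ mu i <> beta i /\ nu i <> beta i)
  (hzero : forall i, mu i = (fun _ => 0%N) \/ nu i = (fun _ => 0%N)
                     \/ beta i = (fun _ => 0%N))
  (hkappa : kappa R mu nu \in unitmx)
  (d : 'I_n -> R) (hd : forall j, 0 < d j)
  (y : ('I_n -> R[i]) -> 'I_n -> R[i]) (e0 : R) (he0 : 0 < e0)
  (hsys : forall r : 'I_n -> R[i], (forall i, cabs (r i) < e0) ->
     forall i, r i * monom (y r) (beta i) + monom (y r) (mu i)
               - monom (y r) (nu i) = 0)
  (hy0 : forall j, y (fun _ => 0) j = 1)
  (hcont : forall eps : R, 0 < eps -> exists delta : R, 0 < delta /\
     forall r : 'I_n -> R[i], (forall i, cabs (r i) < delta) ->
       forall j, cabs (y r j - 1) < eps) :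
  exists rho : R, 0 < rho /\
    forall r : 'I_n -> R[i], (forall i, cabs (r i) < rho) ->
      (* absolute convergence of sum_k c_k r^k over k in Z^n_{>=0} *)
      (exists B : R, forall N : nat,
         \sum_(k : {ffun 'I_n -> 'I_N})
            cabs ((coef mu nu beta d (fun i => nat_of_ord (k i)))%:C
                  * monom r (fun i => nat_of_ord (k i))) <= B) /\
      (* its sum (limit of the partial sums over the boxes [0,N)^n) is y^d(r) *)
      (forall eps : R, 0 < eps -> exists N0 : nat, forall N : nat, (N0 <= N)%N ->
         cabs (\sum_(k : {ffun 'I_n -> 'I_N})
                 (coef mu nu beta d (fun i => nat_of_ord (k i)))%:C
                 * monom r (fun i => nat_of_ord (k i))
               - cpowv (y r) d) < eps).
Proof.
have [eta eta0 uniq_sol] := trinomial_unique beta hkappa.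
set ki := invmx (kappa R mu nu).
pose B := ki *m betabar R beta nu.
pose a0 := ki *m \col_j d j.
have [b Bb] := mx_bounded B.
have [A kiA] := mx_bounded ki.
have [delta [delta0 hdelta]] := hcont _ eta0.
pose K := lco_cst R n b A.
have K0 : 0 <= K by [].
pose c : R := (2 ^ n)%:R * (2 ^ (b.+1 * n))%:R.
have c0 : 0 < c by rewrite mulr_gt0// ltr0n expn_gt0.
(* Closeness to 1 required by both [trinomial_unique] and [one_param_cpow]. *)
pose eta' := Num.min eta 400^-1.
have eta'0 : 0 < eta' by rewrite lt_min eta0 invr_gt0 ltr0n.
(* Target for the ratio of the series: 1/4 for convergence, the second bound to keep [S] within
   [eta'] of 1. [K + 1] keeps the denominator positive. *)
pose q := Num.min 4^-1 (eta' / (4 * (K + 1))).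
have K1 : 0 < 4 * (K + 1) by rewrite mulr_gt0// ltr_wpDl.
have q0 : 0 < q by rewrite lt_min invr_gt0 ltr0n divr_gt0.
(* In turn: the system holds, [y r] is near 1, uniqueness applies, and the ratio of the series is at
   most [q]. *)
pose rho := Num.min (Num.min e0 delta) (Num.min eta (q / c)).
have rho0 : 0 < rho by rewrite !lt_min he0 delta0 eta0 divr_gt0.
exists rho; split=> // r hr.
have re0 i : cabs (r i) < e0 by have := hr i; rewrite !lt_min => /andP[/andP[]].
have rdelta i : cabs (r i) < delta by have := hr i; rewrite !lt_min => /andP[/andP[]].
have reta i : cabs (r i) <= eta by have := hr i; rewrite !lt_min => /andP[_ /andP[/ltW]].
have rrho i : cabs (r i) <= rho by exact: ltW.
have pq : (2 ^ n)%:R * lco_rate n b rho <= q.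
  rewrite /lco_rate mulrA -/c mulrC -ler_pdivlMr//.
  by rewrite /rho !ge_min lexx !orbT.
have p4 : (2 ^ n)%:R * lco_rate n b rho <= 4^-1.
  by apply: le_trans pq _; rewrite ge_min lexx.
have Kp : 4 * K * ((2 ^ n)%:R * lco_rate n b rho) <= eta'.
  apply: le_trans (ler_wpM2l _ pq) _; first by rewrite mulr_ge0.
  apply: le_trans (_ : 4 * (K + 1) * q <= _); first by rewrite ler_wpM2r ?(ltW q0)//; lra.
  by rewrite mulrC -ler_pdivlMr// ge_min lexx orbT.
have [S hS] := lsum_exists hn Bb rrho p4.
have S0 := lsum0 hn rrho p4 hS.
have SD := lsumD hn Bb rrho p4 hS.
pose v j := ki *m delta_mx j 0 : 'cV[R]_n.
have Sclose j t : `|t| <= 1 -> cabs (S (t *: v j) - 1) <= eta'.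
  move=> t1; apply: le_trans Kp; apply: (lsum_close1 hS) => i.
  rewrite mxE normrM; apply: le_trans (_ : 1 * A%:R <= _); last by rewrite mul1r.
  by rewrite ler_pM// /v -colE mxE.
pose Y j := S (v j).
have Yeta : near1 eta Y.
  move=> j; have := Sclose j 1; rewrite scale1r normr1 => /(_ (lexx _)) h.
  by apply: le_trans h _; rewrite ge_min lexx.
(* Relative to [x], the exponent [mu i] adds [e_i] and [beta i] adds [col i B], so equation [i] is
   [lsum_incr] at [x]. *)
have Ysol : trinomial_sol mu nu beta r Y.
  move=> i; rewrite /Y /v !(char_monom S0 SD).
  set x := ki *m \col_j (nu i j)%:R.
  have -> : ki *m \col_j (mu i j)%:R = x + delta_mx i 0.
    rewrite -[delta_mx i 0](mulKmx hkappa) -mulmxDr -colE; congr (_ *m _).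
    by apply/colP => j; rewrite !mxE subrKC.
  have -> : ki *m \col_j (beta i j)%:R = x + col i B.
    rewrite /B colE -mulmxA -colE -mulmxDr; congr (_ *m _).
    by apply/colP => j; rewrite !mxE subrKC.
  by rewrite (lsum_incr hn rrho p4 hS); ring.
have yY j : y r j = Y j.
  apply: (uniq_sol r (y r) Y) => //; last exact: hsys.
  by move=> l; rewrite ltW// hdelta.
have ydE : cpowv (y r) d = S a0.
  rewrite /a0 -(char_prod S0 SD) /cpowv; apply: eq_bigr => j _; rewrite yY.
  apply: (one_param_cpow S0 SD) => [t t1|]; last exact: ltW.
  by apply: le_trans (Sclose j t t1) _; rewrite ge_min lexx orbT.
have termE N (k : {ffun 'I_n -> 'I_N}) :
    (coef mu nu beta d (fun i => nat_of_ord (k i)))%:C * monom r (fun i => nat_of_ord (k i))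
    = lterm B r a0 (fun i => k i).
  by rewrite coef_lco.
split.
  have [A0 a0A] := mx_bounded a0.
  exists (lco_cst R n b A0 * 2 ^+ n) => N.
  under eq_bigr => k _ do rewrite termE.
  by apply: (abs_box hn Bb rrho p4).
move=> eps eps0; have [N0 hN0] := box_lim hn Bb rrho p4 hS a0 eps0.
exists N0 => N NN; rewrite ydE; under eq_bigr => k _ do rewrite termE.
exact: hN0.
Qed.
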